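(* Let $C>1$, $\beta=\int\phi<\infty$, $0<z\le\min\{Ce^{-C\beta},2Ce^{-2C\beta}\}$, and assume $\bar\phi:=\sup_{x\in\mathbb R^d}\phi(x)<\infty$. Then for every $G\in\mathcal L_{2C}$, $t\ge0$, $\varepsilon>0$, $$\|\hat T_{\varepsilon,\mathrm{ren}}(t)G-\hat T_V(t)G\|_C\le\varepsilon t\,\bar\phi(1+\beta)\|G\|_{2C}.$$ In particular $\hat T_{\varepsilon,\mathrm{ren}}(t)G\to\hat T_V(t)G$ in $\mathcal L_C$ as $\varepsilon\to0$ for every $G\in\mathcal L_C$, uniformly for $t$ in bounded intervals.
   Context: $\Gamma_0$: finite subsets of $\mathbb R^d$ with Lebesgue–Poisson measure $\lambda=\sum_{n\ge0}\frac1{n!}m^{(n)}$ ($m^{(0)}=\delta_\emptyset$, $m^{(n)}$ the image of Lebesgue measure on $n$-tuples of distinct points). $|\eta|$ cardinality, $\xi\cup x:=\xi\cup\{x\}$. $e_\lambda(f,\eta)=\prod_{x\in\eta}f(x)$, $e_\lambda(f,\emptyset)=1$. $\mathcal L_C$: measurable $G$ with $\|G\|_C=\int|G(\eta)|C^{|\eta|}d\lambda(\eta)<\infty$. $\phi:\mathbb R^d\to[0,\infty)$ even measurable. $(L_1G)(\eta)=-|\eta|G(\eta)$; $(L_{2,\varepsilon}G)(\eta)=z\sum_{\xi\subset\eta}\int e_\lambda(e^{-\varepsilon\phi(x-\cdot)},\xi)e_\lambda\big(\tfrac{e^{-\varepsilon\phi(x-\cdot)}-1}{\varepsilon},\eta\setminus\xi\big)G(\xi\cup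 x)dx$; $(L_2^VG)(\eta)=z\sum_{\xi\subset\eta}\int G(\xi\cup x)e_\lambda(-\phi(x-\cdot),\eta\setminus\xi)dx$; $\hat L_{\varepsilon,\mathrm{ren}}=L_1+L_{2,\varepsilon}$, $\hat L_V=L_1+L_2^V$ on domain $\mathcal L_{2C}$. Under the stated hypotheses these operators are closable in $\mathcal L_C$ and their closures generate strongly continuous contraction semigroups on $\mathcal L_C$, denoted $\hat T_{\varepsilon,\mathrm{ren}}(t)$ and $\hat T_V(t)$ respectively. *)

(* Defs.v *)
From HB Require Import structures.
From mathcomp Require Import all_boot all_order all_algebra.
From mathcomp Require Import all_classical all_reals all_analysis.
Set Implicit Arguments. Unset Strict Implicit. Unset Printing Implicit Defensive.
Import Order.TTheory GRing.Theory Num.Theory.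
Import numFieldNormedType.Exports.
Local Open Scope classical_set_scope.
Local Open Scope ring_scope.

(** Points of R^d are row vectors 'rV[R]_d; a finite configuration
    eta in Gamma_0 is represented by a finite sequence of points
    (functions on Gamma_0 = permutation-invariant functions on sequences). *)
Definition config (R : realType) (d : nat) := seq 'rV[R]_d.

(** Iterated Lebesgue integral over R^n of a function of n real coordinates
    (by Tonelli/Fubini this is the integral w.r.t. Lebesgue measure on R^n). *)
Fixpoint iint (R : realType) (n : nat) (f : seq R -> \bar R) : \bar R :=
  match n with
  | 0 => f [::]
  | n'.+1 => (\int[@lebesgue_measure R]_t iint n' (fun s => f (t :: s)))%E
  end.

Definition intRd (R : realType) (d : nat) (f : 'rV[R]_d -> \bar R) : \bar R :=
  iint d (fun s => f (\row_(i < d) nth 0 s i)).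

Definition conf_of_seq (R : realType) (d n : nat) (s : seq R) : config R d :=
  [seq \row_(i < d) nth 0 s (k * d + i) | k <- iota 0 n].

Definition int_conf (R : realType) (d n : nat) (F : config R d -> \bar R) : \bar R :=
  iint (n * d) (fun s => F (@conf_of_seq R d n s)).

Definition conf_of_mx (R : realType) (d n : nat) (M : 'M[R]_(n, d)) : config R d :=
  [seq row k M | k <- enum 'I_n].

Definition borel_meas (T : topologicalType) (R : realType) (f : T -> R) : Prop :=
  forall B : set R, measurable B -> <<s open >> (f @^-1` B).

Definition conf_fun (R : realType) (d : nat) (G : config R d -> R) : Prop :=
  (forall eta eta' : config R d, perm_eq eta eta' -> G eta = G eta') /\
  (forall n : nat, borel_meas (fun M : 'M[R]_(n, d) => G (conf_of_mx M))).

(** ||G||_C = \int |G(eta)| C^|eta| d lambda(eta)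
            = sum_n C^n/n! \int_{(R^d)^n} |G(x_1..x_n)| dx *)
Definition normC (R : realType) (d : nat) (C : R) (G : config R d -> R) : \bar R :=
  (\sum_(0 <= n <oo) ((C ^+ n / (n`!)%:R)%R%:E * @int_conf R d n (fun eta => (`|G eta|)%:E)))%E.

Definition LC (R : realType) (d : nat) (C : R) (G : config R d -> R) : Prop :=
  conf_fun G /\ (normC C G < +oo)%E.

(** all splittings eta = xi \cup (eta \ xi), xi \subset eta *)
Fixpoint splits (T : Type) (s : seq T) : seq (seq T * seq T) :=
  match s with
  | [::] => [:: ([::], [::])]
  | y :: s' => [seq (y :: p.1, p.2) | p <- splits s'] ++
               [seq (p.1, y :: p.2) | p <- splits s']
  end.

Definition elam (R : realType) (d : nat) (f : 'rV[R]_d -> R) (eta : config R d) : R :=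
  \prod_(y <- eta) f y.

Definition L1 (R : realType) (d : nat) (G : config R d -> R) : config R d -> R :=
  fun eta => - (size eta)%:R * G eta.

Definition L2eps (R : realType) (d : nat) (z eps : R) (phi : 'rV[R]_d -> R)
    (G : config R d -> R) : config R d -> R :=
  fun eta => z * \sum_(p <- splits eta)
    fine (intRd (fun x =>
      (elam (fun y => expR (- (eps * phi (x - y)))) p.1 *
       elam (fun y => (expR (- (eps * phi (x - y))) - 1) / eps) p.2 *
       G (rcons p.1 x))%:E)).

Definition L2V (R : realType) (d : nat) (z : R) (phi : 'rV[R]_d -> R)
    (G : config R d -> R) : config R d -> R :=
  fun eta => z * \sum_(p <- splits eta)
    fine (intRd (fun x =>
      (G (rcons p.1 x) * elam (fun y => - phi (x - y)) p.2)%:E)).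

Definition Lren (R : realType) (d : nat) (z eps : R) (phi : 'rV[R]_d -> R)
    (G : config R d -> R) : config R d -> R :=
  fun eta => L1 G eta + L2eps z eps phi G eta.

Definition LV (R : realType) (d : nat) (z : R) (phi : 'rV[R]_d -> R)
    (G : config R d -> R) : config R d -> R :=
  fun eta => L1 G eta + L2V z phi G eta.

Definition closure_graph (R : realType) (d : nat) (C : R)
    (A : (config R d -> R) -> (config R d -> R)) (G H : config R d -> R) : Prop :=
  LC C G /\ LC C H /\
  exists Gn : nat -> config R d -> R,
    (forall n, LC (2 * C) (Gn n)) /\
    ((fun n => normC C (fun eta => Gn n eta - G eta)) @ \oo --> 0%E) /\
    ((fun n => normC C (fun eta => A (Gn n) eta - H eta)) @ \oo --> 0%E).

Definition generator_graph (R : realType) (d : nat) (C : R)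
    (T : R -> (config R d -> R) -> (config R d -> R)) (G H : config R d -> R) : Prop :=
  LC C G /\ LC C H /\
  (normC C (fun eta => (T h G eta - G eta) / h - H eta) @[h --> 0^'+] --> 0%E).

(** T is a strongly continuous contraction semigroup on L_C
    (identities holding in L_C, i.e. up to norm-zero functions) *)
Definition C0_contraction_semigroup (R : realType) (d : nat) (C : R)
    (T : R -> (config R d -> R) -> (config R d -> R)) : Prop :=
  (forall t G, 0 <= t -> LC C G -> LC C (T t G)) /\
  (forall t a b G H, 0 <= t -> LC C G -> LC C H ->
     normC C (fun eta => T t (fun xi => a * G xi + b * H xi) eta
                         - (a * T t G eta + b * T t H eta)) = 0%E) /\
  (forall G, LC C G -> normC C (fun eta => T 0 G eta - G eta) = 0%E) /\
  (forall t s G, 0 <= t -> 0 <= s -> LC C G ->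
     normC C (fun eta => T (t + s) G eta - T t (T s G) eta) = 0%E) /\
  (forall t G, 0 <= t -> LC C G -> (normC C (T t G) <= normC C G)%E) /\
  (forall G, LC C G ->
     normC C (fun eta => T h G eta - G eta) @[h --> 0^'+] --> 0%E).

Definition generated_by_closure (R : realType) (d : nat) (C : R)
    (A : (config R d -> R) -> (config R d -> R))
    (T : R -> (config R d -> R) -> (config R d -> R)) : Prop :=
  C0_contraction_semigroup C T /\
  (forall G H, generator_graph C T G H <-> closure_graph C A G H).

(* Main.v *)
Require Import Defs.
From HB Require Import structures.
From mathcomp Require Import all_boot all_order all_algebra.
From mathcomp Require Import all_classical all_reals all_analysis.
From mathcomp Require Import measurable_realfun.
From mathcomp Require Import ring lra zify.
Set Implicit Arguments. Unset Strict Implicit. Unset Printing Implicit Defensive.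
Import Order.TTheory GRing.Theory Num.Theory.
Import numFieldNormedType.Exports.
Local Open Scope classical_set_scope.
Local Open Scope ring_scope.

(** Both generators have the form [A = L1 + S], where [S] is dominated by the
    positive operator with kernel [phi]; Tonelli's theorem and the bounds on [z]
    give [|S F|_c <= | |.| F |_c] for [c = C] and for [c = 2 C].  Hence, with
    [chi_m] the indicator of [|eta| <= m] and [h m <= 1], the truncated explicit
    Euler step [F |-> F + h A (chi_m F)] is a contraction of [L_2C], because the
    gain of [h S] is compensated by the loss of [1 + h L1].  On [L_2C] one has
    [|A A F|_C <= K |F|_2C] and [|A (1 - chi_m) F|_C <= (4 / m) |F|_2C], so one
    step of the Vlasov scheme differs from either semigroup at time [h] by
    [O(h^2 + h / m) |F|_2C], plus, for the rescaled one, by the defect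
    [h |(L_{2,eps} - L_2^V) F|_C <= h eps phibar |F|_2C].  Telescoping over the
    steps and letting [m] tend to infinity gives the estimate, and truncation
    gives the convergence for all of [L_C]. *)

(** A variation-of-constants formula would need one of the two orbits to stay in L_2C, whereas the
    semigroups are known only on L_C, through their axioms and the closure of their generators. The
    Euler iterates replace the missing invariance: they remain in L_2C with norm at most |G|_2C, and
    one and the same iterate is compared with both semigroups. Truncation serves two purposes. It
    keeps the factor 1 - h |eta| nonnegative, and it makes A chi_m F an element of L_2C again, so
    that chi_m F lies in the domain of the square of the generator. No integral of an L_C-valued
    function is formed; the Taylor estimates for a semigroup come from subdividing time. The
    constant K arises by passing through L_{3C/2}, and 4 / m from n^2 <= 2^(n+1). The defect bound
    is free of beta: with u = C beta, 2 u <= e^u turns z e^(2u) <= 2C into z e^u u <= C. *)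

(** * Iterated Lebesgue integrals: measurability, Tonelli, linearity *)

Section IteratedIntegral.
Variable R : realType.
Implicit Types (n m : nat) (f g : seq R -> \bar R).

Local Notation mu := (@lebesgue_measure R).

(* Joint measurability in the parameter and in the first [n] coordinates is
   tested against all measurable maps into the parameter space and the
   coordinate lines; no sigma-algebra on [seq R] is needed. *)
Definition jmeas d (Z : measurableType d) n (f : Z -> seq R -> \bar R) :=
  forall d' (W : measurableType d') (p : W -> Z) (l : seq (W -> R)),
    measurable_fun setT p -> List.Forall (measurable_fun setT) l ->
    size l = n -> measurable_fun setT (fun w => f (p w) [seq h w | h <- l]).

Definition smeas n f :=
  forall d' (W : measurableType d') (l : seq (W -> R)),
    List.Forall (measurable_fun setT) l ->
    size l = n -> measurable_fun setT (fun w => f [seq h w | h <- l]).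

Lemma jmeas_smeas d (Z : measurableType d) n (f : Z -> seq R -> \bar R) z :
  jmeas n f -> smeas n (f z).
Proof. by move=> mf d' W l ml sl; apply: (mf d' W (fun=> z)). Qed.

Lemma smeas_cons n f : smeas n.+1 f -> jmeas n (fun t s => f (t :: s)).
Proof.
move=> mf d' W p l mp ml sl; apply: (mf d' W (p :: l)); last by rewrite /= sl.
exact: List.Forall_cons.
Qed.

Lemma smeas_cons1 n f t : smeas n.+1 f -> smeas n (fun s => f (t :: s)).
Proof. by move=> /smeas_cons /jmeas_smeas; exact. Qed.

Lemma jmeas_cons d (Z : measurableType d) n (f : Z -> seq R -> \bar R) :
  jmeas n.+1 f -> jmeas n (fun (q : Z * R) s => f q.1 (q.2 :: s)).
Proof.
move=> mf d' W p l mp ml sl.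
apply: (mf d' W (fst \o p) ((snd \o p) :: l)); last by rewrite /= sl.
  exact: (measurableT_comp measurable_fst mp).
by apply: List.Forall_cons => //; exact: (measurableT_comp measurable_snd mp).
Qed.

(** Measurability of partial integrals is a Tonelli statement about nonnegative functions, hence the
    splitting into positive and negative parts. *)
Lemma measurable_integral_param d (Z : measurableType d) (g : Z * R -> \bar R) :
  measurable_fun setT g -> measurable_fun setT (fun z => \int[mu]_t g (z, t))%E.
Proof.
move=> mg.
have -> : (fun z => \int[mu]_t g (z, t))%E =
  (fun z => \int[mu]_t (g^\+ (z, t)) - \int[mu]_t (g^\- (z, t)))%E.
  by apply/funext => z; rewrite integralE; congr (_ - _)%E;
    apply: eq_integral => t _; rewrite ?funeposE ?funenegE.
apply: emeasurable_funB.
- by apply: (measurable_fun_fubini_tonelli_F (m2 := mu) (g^\+)%E) => //;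
    exact: measurable_funepos.
- by apply: (measurable_fun_fubini_tonelli_F (m2 := mu) (g^\-)%E) => //;
    exact: measurable_funeneg.
Qed.

Lemma measurable_iint d (Z : measurableType d) n (f : Z -> seq R -> \bar R) :
  jmeas n f -> measurable_fun setT (fun z => iint n (f z)).
Proof.
elim: n d Z f => [|n IH] d Z f mf /=.
  by apply: (mf _ Z idfun [::]) => //; exact: measurable_id.
apply: (@measurable_integral_param _ Z (fun q => iint n (fun s => f q.1 (q.2 :: s)))).
by apply: IH; exact: jmeas_cons.
Qed.

Lemma measurable_iint1 n f : smeas n.+1 f ->
  measurable_fun setT (fun t => iint n (fun s => f (t :: s))).
Proof. by move=> mf; apply: measurable_iint; exact: smeas_cons. Qed.

Lemma eq_iint n f g : (forall s, size s = n -> f s = g s) -> iint n f = iint n g.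
Proof.
elim: n f g => [|n IH] f g fg /=; first exact: fg.
by apply: eq_integral => t _; apply: IH => s ss; apply: fg; rewrite /= ss.
Qed.

Lemma iint_ge0 n f : (forall s, size s = n -> (0 <= f s)%E) -> (0 <= iint n f)%E.
Proof.
elim: n f => [|n IH] f f0 /=; first exact: f0.
by apply: integral_ge0 => t _; apply: IH => s ss; apply: f0; rewrite /= ss.
Qed.

Lemma le_iint n f g : (forall s, size s = n -> (0 <= f s)%E) ->
  smeas n f -> smeas n g ->
  (forall s, size s = n -> (f s <= g s)%E) -> (iint n f <= iint n g)%E.
Proof.
elim: n f g => [|n IH] f g f0 mf mg fg /=; first exact: fg.
apply: ge0_le_integral => //.
- by move=> t _; apply: iint_ge0 => s ss; apply: f0; rewrite /= ss.
- exact: measurable_iint1.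
- exact: measurable_iint1.
- move=> t _; apply: IH => [s ss|||s ss]; [|exact: smeas_cons1|exact: smeas_cons1|].
  + by apply: f0; rewrite /= ss.
  + by apply: fg; rewrite /= ss.
Qed.

Lemma iintD n f g : (forall s, size s = n -> (0 <= f s)%E) ->
  (forall s, size s = n -> (0 <= g s)%E) -> smeas n f -> smeas n g ->
  iint n (fun s => f s + g s)%E = (iint n f + iint n g)%E.
Proof.
elim: n f g => [|n IH] f g f0 g0 mf mg //=.
rewrite -ge0_integralD//; last 4 first.
- by move=> t _; apply: iint_ge0 => s ss; apply: f0; rewrite /= ss.
- exact: measurable_iint1.
- by move=> t _; apply: iint_ge0 => s ss; apply: g0; rewrite /= ss.
- exact: measurable_iint1.
apply: eq_integral => t _; apply: (IH (fun s => f (t :: s)) (fun s => g (t :: s))).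
- by move=> s ss; apply: f0; rewrite /= ss.
- by move=> s ss; apply: g0; rewrite /= ss.
- exact: smeas_cons1.
- exact: smeas_cons1.
Qed.

Lemma iintZ n f (k : \bar R) : (0 <= k)%E ->
  (forall s, size s = n -> (0 <= f s)%E) -> smeas n f ->
  iint n (fun s => k * f s)%E = (k * iint n f)%E.
Proof.
move=> k0; elim: n f => [|n IH] f f0 mf //=.
rewrite -ge0_integralZl//; last 2 first.
- exact: measurable_iint1.
- by move=> t _; apply: iint_ge0 => s ss; apply: f0; rewrite /= ss.
apply: eq_integral => t _; apply: (IH (fun s => f (t :: s))).
- by move=> s ss; apply: f0; rewrite /= ss.
- exact: smeas_cons1.
Qed.

Lemma iint0 n : iint n (fun _ : seq R => 0%E) = 0%E.
Proof. by elim: n => //= n IH; under eq_integral do rewrite IH; rewrite integral0. Qed.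

Lemma smeas_abs n f : smeas n f -> smeas n (fun s => `|f s|)%E.
Proof.
move=> mf d' W l ml sl.
by apply: measurableT_comp (mf d' W l ml sl); exact: abse_measurable.
Qed.

Lemma abse_iint_le n f : smeas n f -> (`|iint n f| <= iint n (fun s => `|f s|))%E.
Proof.
elim: n f => [|n IH] f mf //=.
apply: le_trans (le_abse_integral _ _ _) _ => //; first exact: measurable_iint1.
apply: ge0_le_integral => //.
- by apply: measurableT_comp (measurable_iint1 mf); exact: abse_measurable.
- by apply: (@measurable_iint1 _ (fun s => `|f s|%E)); exact: smeas_abs.
- by move=> t _; apply: IH; exact: smeas_cons1.
Qed.

Lemma iint_cat m n f :
  iint (m + n) f = iint m (fun s1 => iint n (fun s2 => f (s1 ++ s2))).
Proof. by elim: m f => //= m IH f; apply: eq_integral => t _; rewrite IH. Qed.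

Lemma iint_int_swap n (f : R -> seq R -> \bar R) :
  (forall t s, (0 <= f t s)%E) -> jmeas n f ->
  (\int[mu]_t iint n (f t) = iint n (fun s => \int[mu]_t f t s))%E.
Proof.
elim: n f => [|n IH] f f0 mf //=.
rewrite (fubini_tonelli (m1 := mu) (m2 := mu) (fun q => iint n (fun s => f q.1 (q.2 :: s))))/=.
- apply: eq_integral => u _; apply: (IH (fun t s => f t (u :: s))) => //.
  move=> d' W p l mp ml sl.
  by apply: (mf d' W p (cst u :: l)) => //=; [exact: List.Forall_cons|rewrite sl].
- by apply: measurable_iint; exact: jmeas_cons.
- by move=> q; apply: iint_ge0.
Qed.

(** The measurability hypothesis tests both sequences at once, because [seq R] carries no
    sigma-algebra and cannot be the parameter space of [jmeas]. *)
Lemma iint_swap m n (f : seq R -> seq R -> \bar R) :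
  (forall s t, (0 <= f s t)%E) ->
  (forall d' (W : measurableType d') (l l' : seq (W -> R)),
    List.Forall (measurable_fun setT) l -> size l = m ->
    List.Forall (measurable_fun setT) l' -> size l' = n ->
    measurable_fun setT (fun w => f [seq h w | h <- l] [seq h w | h <- l'])) ->
  iint m (fun s => iint n (f s)) = iint n (fun t => iint m (f^~ t)).
Proof.
elim: m f => [|m IH] f f0 mf //=.
transitivity (\int[mu]_t iint n (fun s' => iint m (fun s => f (t :: s) s')))%E.
  apply: eq_integral => t _; apply: (IH (fun s => f (t :: s))) => // d' W l l' ml sl ml' sl'.
  by apply: (mf d' W (cst t :: l)) => //=; [exact: List.Forall_cons|rewrite sl].
rewrite (@iint_int_swap n (fun t s' => iint m (fun s => f (t :: s) s')))//.
  by move=> t s; apply: iint_ge0.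
move=> d' W p l mp ml sl.
apply: (@measurable_iint _ _ _ (fun w s => f (p w :: s) [seq h w | h <- l])).
move=> d2 W2 p2 l2 mp2 ml2 sl2.
rewrite (_ : (fun _ => _) = fun w => f [seq h w | h <- (p \o p2) :: l2]
    [seq h w | h <- [seq h \o p2 | h <- l]]); last first.
  by apply/funext => w; rewrite /= -map_comp.
apply: mf.
- by apply: List.Forall_cons => //; exact: measurableT_comp.
- by rewrite /= sl2.
- apply/List.Forall_map; apply: List.Forall_impl ml => h mh.
  exact: measurableT_comp.
- by rewrite size_map.
Qed.

(** Finiteness of the full absolute integrals gives finite inner ones only for almost every first
    coordinate; the induction hypothesis is used there, and the outer integrals are compared almost
    everywhere. *)
Lemma iintB n (f g : seq R -> R) :
  smeas n (fun s => (f s)%:E) -> smeas n (fun s => (g s)%:E) ->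
  (iint n (fun s => `|(f s)%:E|) < +oo)%E -> (iint n (fun s => `|(g s)%:E|) < +oo)%E ->
  iint n (fun s => (f s - g s)%:E) =
  (iint n (fun s => (f s)%:E) - iint n (fun s => (g s)%:E))%E.
Proof.
elim: n f g => [|n IH] f g mf mg fi gi //=.
have mB : smeas n.+1 (fun s => (f s - g s)%:E).
  by move=> d' W l ml sl; exact: (emeasurable_funB (mf d' W l ml sl) (mg d' W l ml sl)).
have mi (h : seq R -> R) : smeas n.+1 (fun s => (h s)%:E) ->
    (iint n.+1 (fun s => `|(h s)%:E|) < +oo)%E ->
    mu.-integrable setT (fun t => iint n (fun s => `|(h (t :: s))%:E|))%E.
  move=> mh hi; apply/integrableP; split.
    by apply: (@measurable_iint1 _ (fun s => `|(h s)%:E|%E)); exact: smeas_abs.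
  apply: le_lt_trans hi => /=; rewrite le_eqVlt; apply/orP; left; apply/eqP.
  by apply: eq_integral => t _; rewrite gee0_abs//; exact: iint_ge0.
have mi' (h : seq R -> R) : smeas n.+1 (fun s => (h s)%:E) ->
    (iint n.+1 (fun s => `|(h s)%:E|) < +oo)%E ->
    mu.-integrable setT (fun t => iint n (fun s => (h (t :: s))%:E))%E.
  move=> mh hi; apply: le_integrable (mi h mh hi) => //.
    by apply: (@measurable_iint1 _ (fun s => (h s)%:E)).
  move=> t _; rewrite [leRHS]gee0_abs; last exact: iint_ge0.
  by apply: abse_iint_le; exact: (@smeas_cons1 _ (fun s => (h s)%:E)).
rewrite -integralB//; [|exact: mi'|exact: mi'].
apply: ae_eq_integral => //.
- by apply: (@measurable_iint1 _ (fun s => (f s - g s)%:E)).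
- apply: emeasurable_funB; first exact: (@measurable_iint1 _ (fun s => (f s)%:E)).
  exact: (@measurable_iint1 _ (fun s => (g s)%:E)).
have := integrable_ae measurableT (mi g mg gi).
have := integrable_ae measurableT (mi f mf fi).
apply: filterS2 => t /= tf tg _.
apply: (IH (fun s => f (t :: s)) (fun s => g (t :: s))).
- exact: (@smeas_cons1 _ (fun s => (f s)%:E)).
- exact: (@smeas_cons1 _ (fun s => (g s)%:E)).
- by rewrite ltey_eq tf.
- by rewrite ltey_eq tg.
Qed.

End IteratedIntegral.

(** * Translation invariance *)

Section Translation.
Variable R : realType.
Local Notation mu := (@lebesgue_measure R).

(** The push-forward of Lebesgue measure under t - a agrees with it on half-open intervals, so
    uniqueness identifies the two measures. *)
Lemma ge0_integral_shift (f : R -> \bar R) (a : R) : measurable_fun setT f ->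
  (forall t, (0 <= f t)%E) -> (\int[mu]_t f (t - a)%R = \int[mu]_t f t)%E.
Proof.
move=> mf f0.
have mB : @measurable_fun _ _ (measurableTypeR R) (measurableTypeR R) setT (fun t : R => t - a).
  by apply: measurable_funB; [exact: measurable_id|exact: measurable_cst].
have <- := ge0_integral_pushforward mB (@lebesgue_measure R) measurableT mf (fun t _ => f0 t).
pose nu : measure (measurableTypeR R) R :=
  measure_function_pushforward__canonical__measure_function_Measure mu mB.
apply: (@eq_measure_integral _ _ _ setT _ nu) => A mA _.
suff H X : ocitv X -> lebesgue_measure X = nu X.
  by rewrite -(lebesgue_measure_unique H).
move=> [[x y] _ <-].
rewrite /= /pushforward.
have -> : (fun t : R => t - a) @^-1` `]x, y] = `]x + a, y + a]%classic.
  by apply/seteqP; split => t /=; rewrite !in_itv/= ltrBrDr lerBlDr.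
rewrite !lebesgue_measure_itv/= !lte_fin ltrD2r; case: ifPn => // _.
by rewrite -!EFinB; congr (_ %:E); ring.
Qed.

Lemma iint_shift n (f : seq R -> \bar R) (a : seq R) : size a = n ->
  (forall s, (0 <= f s)%E) -> smeas n f ->
  iint n (fun s => f [seq q.1 - q.2 | q <- zip s a]) = iint n f.
Proof.
elim: n f a => [|n IH] f [|x a]//= [sa] f0 mf.
rewrite -(@ge0_integral_shift (fun t => iint n (fun s => f (t :: s))) x); last 2 first.
- exact: measurable_iint1.
- by move=> t; exact: iint_ge0.
apply: eq_integral => t _.
by rewrite -(IH (fun s => f (t - x :: s)) a)//; exact: smeas_cons1.
Qed.

End Translation.

(** * Borel functions of a matrix composed with entrywise measurable maps *)

Section BorelMatrix.
Variables (R : realType) (n d : nat).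

Let box (q : 'M[rat]_(n, d)) (k : nat) : set 'M[R]_(n, d) :=
  [set N | forall i j, `|ratr (q i j) - N i j| < k.+1%:R^-1].

(** Boxes with rational centre and radius 1/(k+1) are countably many, so the Borel sigma-algebra is
    generated by conditions on single entries. *)
Lemma open_bigcup_box (U : set 'M[R]_(n, d)) : open U ->
  U = \bigcup_(qk in [set qk | box qk.1 qk.2 `<=` U]) box qk.1 qk.2.
Proof.
move=> oU; apply/seteqP; split => [N UN|N [qk /= bU]]; last exact: bU.
have /nbhs_ballP[e /= e0 eU] : nbhs N U by apply: open_nbhs_nbhs; split.
have e20 : 0 < e / 2 by rewrite divr_gt0.
have [k ke] : exists k : nat, k.+1%:R^-1 < e / 2.
  have [k _ /(_ k (leqnn k))] := near_infty_natSinv_lt (PosNum e20).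
  by exists k.
have hq i j : exists q : rat, `|ratr q - N i j| < k.+1%:R^-1.
  have : N i j - k.+1%:R^-1 < N i j + k.+1%:R^-1.
    by rewrite ltrD2l gt0_cp// ?invr_gt0.
  move=> /rat_in_itvoo[q]; rewrite in_itv/= => qN; exists q.
  by rewrite ltr_distl.
pose q := \matrix_(i, j) sval (cid (hq i j)).
have qP i j : `|ratr (q i j) - N i j| < k.+1%:R^-1.
  by rewrite mxE; case: cid.
exists (q, k) => //= N' N'q; apply: eU; split=> // i j; rewrite /ball/=.
rewrite [e]splitr (le_lt_trans (ler_distD (ratr (q i j)) _ _))// ltrD//.
  by rewrite distrC (lt_trans (qP i j)).
by rewrite (lt_trans (N'q i j)).
Qed.

(** The sets with measurable preimage form a sigma-algebra. It contains the boxes, whose preimages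
    are finite intersections of conditions on entries, and hence all open sets. *)
Lemma borel_meas_comp (f : 'M[R]_(n, d) -> R) dW (W : measurableType dW)
    (M : W -> 'M[R]_(n, d)) : borel_meas f ->
  (forall i j, measurable_fun setT (fun w => M w i j)) ->
  measurable_fun setT (fun w => f (M w)).
Proof.
move=> bf mM _ B mB; rewrite setTI.
suff H : <<s open >> `<=` [set A : set 'M[R]_(n, d) | measurable (M @^-1` A)].
  exact: (H _ (bf _ mB)).
apply: smallest_sub.
  split => /=.
  - by rewrite preimage_set0.
  - by move=> A mA; rewrite setTD preimage_setC; exact: measurableC.
  - by move=> F mF; rewrite preimage_bigcup; exact: bigcupT_measurable.
move=> U /= /open_bigcup_box ->; rewrite preimage_bigcup bigcup_mkcond.
apply: countable_bigcupT_measurable => [|[q k]]/=; first exact: countableP.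
case: ifPn => // _.
rewrite (_ : _ @^-1` _ = \bigcap_(ij in [set: 'I_n * 'I_d])
  (fun w => `|ratr (q ij.1 ij.2) - M w ij.1 ij.2|) @^-1` `]-oo, k.+1%:R^-1[); last first.
  apply/seteqP; split=> w /= H; first by move=> [i j] _ /=; rewrite in_itv/=; exact: H.
  by move=> i j; have := H (i, j) I; rewrite /= in_itv.
apply: fin_bigcap_measurable => // -[i j] _ /=; rewrite -[X in measurable X]setTI.
have mm : measurable_fun setT (fun w => `|ratr (q i j) - M w i j| : R).
  apply: measurableT_comp => //; apply: measurable_funB => //.
exact: mm.
Qed.

End BorelMatrix.

(** * Measurability and integration for points and configurations *)

Section Configurations.
Variables (R : realType) (d : nat).
Local Notation point := 'rV[R]_d.
Local Notation config := (config R d).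
Implicit Types (F : config -> \bar R) (f : point -> \bar R).

(** Maps into points are tested coordinatewise; [rmeas] and [cmeas] then test functions of a point
    or of a configuration against all such maps, in the manner of [smeas]. *)
Definition mrow dW (W : measurableType dW) (p : W -> point) :=
  forall i, measurable_fun setT (fun w => p w 0 i).

Definition rmeas f := forall dW (W : measurableType dW) (p : W -> point),
  mrow p -> measurable_fun setT (fun w => f (p w)).

Definition cmeas F := forall dW (W : measurableType dW) (l : seq (W -> point)),
  List.Forall (@mrow _ W) l -> measurable_fun setT (fun w => F [seq p w | p <- l]).

Lemma mrow_comp dW (W : measurableType dW) dV (V : measurableType dV)
    (p : W -> point) (q : V -> W) :
  mrow p -> measurable_fun setT q -> mrow (p \o q).
Proof. by move=> mp mq i; exact: (measurableT_comp (mp i) mq). Qed.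

Lemma mrow_cst dW (W : measurableType dW) (x : point) : mrow (fun _ : W => x).
Proof. by move=> i; exact: measurable_cst. Qed.

Lemma mrowB dW (W : measurableType dW) (p q : W -> point) :
  mrow p -> mrow q -> mrow (fun w => p w - q w).
Proof.
move=> mp mq i; under eq_fun do rewrite !mxE.
by apply: measurable_funB; [exact: mp|exact: mq].
Qed.

Lemma measurable_nth dW (W : measurableType dW) (l : seq (W -> R)) k :
  List.Forall (measurable_fun setT) l ->
  measurable_fun setT (fun w => nth 0 [seq h w | h <- l] k).
Proof.
elim: l k => [|h l IH] [|k] //= /List.Forall_cons_iff[mh ml] //.
exact: IH.
Qed.

Lemma mrow_row dW (W : measurableType dW) (l : seq (W -> R)) (k : nat -> nat) :
  List.Forall (measurable_fun setT) l ->
  mrow (fun w => \row_(i < d) nth 0 [seq h w | h <- l] (k i)).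
Proof.
by move=> ml i; under eq_fun do rewrite mxE; exact: measurable_nth.
Qed.

Lemma conf_of_seq_map n dW (W : measurableType dW) (l : seq (W -> R)) w :
  conf_of_seq d n [seq h w | h <- l] =
  [seq p w | p <- [seq (fun w => \row_(i < d) nth 0 [seq h w | h <- l] (k * d + i))
                  | k <- iota 0 n]].
Proof. by rewrite -map_comp. Qed.

Lemma mrow_conf_of_seq n dW (W : measurableType dW) (l : seq (W -> R)) :
  List.Forall (measurable_fun setT) l ->
  List.Forall (@mrow _ W)
    [seq (fun w => \row_(i < d) nth 0 [seq h w | h <- l] (k * d + i)) | k <- iota 0 n].
Proof.
move=> ml; elim: (iota 0 n) => [|k s IH] /=; first by constructor.
by constructor => //; exact: (@mrow_row _ _ l (fun i => (k * d + i)%N)).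
Qed.

Lemma size_conf_of_seq n (s : seq R) : size (conf_of_seq d n s) = n.
Proof. by rewrite size_map size_iota. Qed.

Lemma smeas_row f : rmeas f -> smeas d (fun s => f (\row_(i < d) nth 0 s i)).
Proof.
by move=> mf dW W l ml _; apply: mf; exact: (@mrow_row _ _ l idfun).
Qed.

Lemma smeas_conf n F : cmeas F -> smeas (n * d) (fun s => F (conf_of_seq d n s)).
Proof.
move=> mF dW W l ml _; under eq_fun do rewrite conf_of_seq_map.
by apply: mF; exact: mrow_conf_of_seq.
Qed.

Lemma measurable_intRd dZ (Z : measurableType dZ) (f : Z -> point -> \bar R) :
  (forall dW (W : measurableType dW) (q : W -> Z) (p : W -> point),
     measurable_fun setT q -> mrow p -> measurable_fun setT (fun w => f (q w) (p w))) ->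
  measurable_fun setT (fun z => intRd (f z)).
Proof.
move=> mf; apply: measurable_iint => dW W q l mq ml _; apply: mf => //.
exact: (@mrow_row _ _ l idfun).
Qed.

Lemma measurable_int_conf n dZ (Z : measurableType dZ) (F : Z -> config -> \bar R) :
  (forall dW (W : measurableType dW) (q : W -> Z) (l : seq (W -> point)),
     measurable_fun setT q -> List.Forall (@mrow _ W) l ->
     measurable_fun setT (fun w => F (q w) [seq p w | p <- l])) ->
  measurable_fun setT (fun z => int_conf n (F z)).
Proof.
move=> mF; apply: measurable_iint => dW W q l mq ml _.
by under eq_fun do rewrite conf_of_seq_map; apply: mF => //; exact: mrow_conf_of_seq.
Qed.

Lemma eq_intRd f g : f =1 g -> intRd f = intRd g.
Proof. by move=> fg; apply: eq_iint => s _; exact: fg. Qed.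

Lemma intRd_ge0 f : (forall x, (0 <= f x)%E) -> (0 <= intRd f)%E.
Proof. by move=> f0; apply: iint_ge0. Qed.

Lemma le_intRd f g : (forall x, (0 <= f x)%E) -> rmeas f -> rmeas g ->
  (forall x, (f x <= g x)%E) -> (intRd f <= intRd g)%E.
Proof. by move=> f0 mf mg fg; apply: le_iint => //; exact: smeas_row. Qed.

Lemma intRdD f g : (forall x, (0 <= f x)%E) -> (forall x, (0 <= g x)%E) ->
  rmeas f -> rmeas g -> intRd (fun x => f x + g x)%E = (intRd f + intRd g)%E.
Proof.
move=> f0 g0 mf mg.
by apply: (iintD (f := fun s => f (\row_i nth 0 s i))
                 (g := fun s => g (\row_i nth 0 s i))) => //; exact: smeas_row.
Qed.

Lemma intRdZ f (k : \bar R) : (0 <= k)%E -> (forall x, (0 <= f x)%E) ->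
  rmeas f -> intRd (fun x => k * f x)%E = (k * intRd f)%E.
Proof.
move=> k0 f0 mf.
by apply: (iintZ (f := fun s => f (\row_i nth 0 s i))) => //; exact: smeas_row.
Qed.

Lemma intRd0 : intRd (fun _ : point => 0%E) = 0%E. Proof. exact: iint0. Qed.

Lemma intRd_sum (I : Type) (r : seq I) (f : I -> point -> \bar R) :
  (forall i x, (0 <= f i x)%E) -> (forall i, rmeas (f i)) ->
  intRd (fun x => \sum_(i <- r) f i x)%E = (\sum_(i <- r) intRd (f i))%E.
Proof.
move=> f0 mf; elim: r => [|i r IH].
  by rewrite [RHS]big_nil; apply: etrans intRd0; apply: eq_intRd => x; rewrite big_nil.
rewrite big_cons -IH -intRdD//.
- by apply: eq_intRd => x; rewrite big_cons.
- by move=> x; apply: sume_ge0.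
- by move=> dW W p mp; apply: emeasurable_sum => j; exact: mf.
Qed.

Lemma abse_intRd_le f : rmeas f -> (`|intRd f| <= intRd (fun x => `|f x|))%E.
Proof. by move=> mf; apply: abse_iint_le; exact: smeas_row. Qed.

Lemma intRdB (f g : point -> R) :
  rmeas (fun x => (f x)%:E) -> rmeas (fun x => (g x)%:E) ->
  (intRd (fun x => `|(f x)%:E|) < +oo)%E -> (intRd (fun x => `|(g x)%:E|) < +oo)%E ->
  intRd (fun x => (f x - g x)%:E) =
  (intRd (fun x => (f x)%:E) - intRd (fun x => (g x)%:E))%E.
Proof.
move=> mf mg fi gi.
apply: (iintB (f := fun s => f (\row_i nth 0 s i))
              (g := fun s => g (\row_i nth 0 s i))) => //.
  exact: (smeas_row (f := fun x => (f x)%:E)).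
exact: (smeas_row (f := fun x => (g x)%:E)).
Qed.

Lemma intRd_shift f (a : point) : (forall x, (0 <= f x)%E) -> rmeas f ->
  intRd (fun x => f (x - a)) = intRd f.
Proof.
move=> f0 mf; pose e := [seq a 0 i | i <- enum 'I_d].
have se : size e = d by rewrite size_map size_enum_ord.
have ne (i : 'I_d) : nth 0 e i = a 0 i by rewrite (nth_map i) ?size_enum_ord// nth_ord_enum.
rewrite [RHS]/intRd -(iint_shift se)//; last exact: smeas_row.
apply: eq_iint => s ss; congr f; apply/rowP => i; rewrite !mxE -ne.
by rewrite (nth_map (0, 0)) ?nth_zip ?size_zip ?ss ?se ?minnn.
Qed.

Lemma int_conf0 F : int_conf 0 F = F [::]. Proof. by []. Qed.

Lemma int_confS n F :
  int_conf n.+1 F = intRd (fun x => int_conf n (fun eta => F (x :: eta))).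
Proof.
rewrite /int_conf mulSn iint_cat; apply: eq_iint => s1 ss1; apply: eq_iint => s2 _.
congr F; rewrite /conf_of_seq /=; congr (_ :: _).
  by apply/rowP => i; rewrite !mxE mul0n add0n nth_cat ss1 ltn_ord.
rewrite -addn1 addnC iotaDl -map_comp; apply: eq_map => k /=.
apply/rowP => i; rewrite !mxE nth_cat ss1 mulnDl mul1n -addnA.
by rewrite ltnNge leq_addr/= addKn.
Qed.

Lemma eq_int_conf n F G : (forall eta, size eta = n -> F eta = G eta) ->
  int_conf n F = int_conf n G.
Proof. by move=> FG; apply: eq_iint => s _; apply: FG; rewrite size_conf_of_seq. Qed.

Lemma int_conf_ge0 n F : (forall eta, (0 <= F eta)%E) -> (0 <= int_conf n F)%E.
Proof. by move=> F0; apply: iint_ge0. Qed.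

Lemma le_int_conf n F G : (forall eta, (0 <= F eta)%E) -> cmeas F -> cmeas G ->
  (forall eta, size eta = n -> (F eta <= G eta)%E) -> (int_conf n F <= int_conf n G)%E.
Proof.
move=> F0 mF mG FG; apply: le_iint => //; [exact: smeas_conf|exact: smeas_conf|].
by move=> s _; apply: FG; rewrite size_conf_of_seq.
Qed.

Lemma int_confD n F G : (forall eta, (0 <= F eta)%E) -> (forall eta, (0 <= G eta)%E) ->
  cmeas F -> cmeas G ->
  int_conf n (fun eta => F eta + G eta)%E = (int_conf n F + int_conf n G)%E.
Proof.
move=> F0 G0 mF mG.
by apply: (iintD (f := fun s => F (conf_of_seq d n s))
                 (g := fun s => G (conf_of_seq d n s))) => //; exact: smeas_conf.
Qed.

Lemma int_confZ n F (k : \bar R) : (0 <= k)%E -> (forall eta, (0 <= F eta)%E) ->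
  cmeas F -> int_conf n (fun eta => k * F eta)%E = (k * int_conf n F)%E.
Proof.
move=> k0 F0 mF.
by apply: (iintZ (f := fun s => F (conf_of_seq d n s))) => //; exact: smeas_conf.
Qed.

Lemma int_conf_intRd_swap n (f : config -> point -> \bar R) :
  (forall eta x, (0 <= f eta x)%E) ->
  (forall dW (W : measurableType dW) (l : seq (W -> point)) (p : W -> point),
     List.Forall (@mrow _ W) l -> mrow p ->
     measurable_fun setT (fun w => f [seq q w | q <- l] (p w))) ->
  int_conf n (fun eta => intRd (f eta)) = intRd (fun x => int_conf n (f^~ x)).
Proof.
move=> f0 mf.
apply: (@iint_swap _ (n * d) d (fun s t => f (conf_of_seq d n s) (\row_i nth 0 t i))) => //.
move=> dW W l l' ml _ ml' _; under eq_fun do rewrite conf_of_seq_map.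
by apply: mf; [exact: mrow_conf_of_seq|exact: (@mrow_row _ _ l' idfun)].
Qed.

Lemma mrow_borel_meas (phi : point -> R) dW (W : measurableType dW) (p : W -> point) :
  borel_meas phi -> mrow p -> measurable_fun setT (fun w => phi (p w)).
Proof. by move=> bp mp; apply: (borel_meas_comp bp) => i j; rewrite ord1. Qed.

Lemma measurable_conf_fun (G : config -> R) dW (W : measurableType dW)
    (l : seq (W -> point)) :
  conf_fun G -> List.Forall (@mrow _ W) l ->
  measurable_fun setT (fun w => G [seq p w | p <- l]).
Proof.
move=> [_ bG] ml.
pose M (w : W) : 'M[R]_(size l, d) := \matrix_(k, i) nth (fun=> 0) l k w 0 i.
rewrite (_ : (fun _ => _) = fun w => G (conf_of_mx (M w))); last first.
  apply/funext => w; congr G; apply: (@eq_from_nth _ 0).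
    by rewrite 2!size_map size_enum_ord.
  move=> k; rewrite size_map => kl; rewrite (nth_map (fun=> 0))//.
  rewrite (nth_map (Ordinal kl)) ?size_enum_ord//; apply/rowP => i; rewrite !mxE.
  by rewrite nth_enum_ord.
apply: (borel_meas_comp (bG _)) => k i; under eq_fun do rewrite mxE.
have kl := ltn_ord k; move: (nat_of_ord k) kl => {}k kl.
elim: l k kl ml {M} => [|p l IH] [|k] //= kl /List.Forall_cons_iff[mp ml]; first exact: mp.
exact: IH.
Qed.

(** Converse of [measurable_conf_fun]: the universal test is the matrix space with its Borel
    sigma-algebra, with the rows as maps into points. *)
Lemma conf_funP (G : config -> R) :
  (forall eta eta', perm_eq eta eta' -> G eta = G eta') ->
  (forall dW (W : measurableType dW) (l : seq (W -> point)),
    List.Forall (@mrow _ W) l -> measurable_fun setT (fun w => G [seq p w | p <- l])) ->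
  conf_fun G.
Proof.
move=> pG mG; split=> // n B mB.
pose W := g_sigma_algebraType (@open 'M[R]_(n, d)).
have mrowk (k : 'I_n) : @mrow _ W (fun M : 'M[R]_(n, d) => row k M).
  move=> i; under eq_fun do rewrite mxE.
  apply: (measurability _ (RGenOpens.measurableE R)).
  move=> _ [_ [a [b ->] <-]]; rewrite setTI; apply: sub_sigma_algebra.
  by apply: open_comp; [move=> M _; exact: coord_continuous|exact: interval_open].
have ml : List.Forall (@mrow _ W) [seq (fun M : 'M[R]_(n, d) => row k M) | k <- enum 'I_n].
  by elim: (enum 'I_n) => [|k s IH] /=; constructor.
have := mG _ W _ ml measurableT B mB; rewrite setTI.
rewrite (_ : (fun _ => _) = fun M : 'M[R]_(n, d) => G (conf_of_mx M))//.
by apply/funext => M; rewrite -map_comp.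
Qed.

End Configurations.

(** * Sums over splittings of a configuration *)

Section Splits.

(** Lets a sum over the splittings of an evaluated list of maps be read as a finite sum over the
    splittings of the list itself; this is how such sums are shown to be measurable. *)
Lemma splits_map (T U : Type) (h : T -> U) (s : seq T) :
  splits (map h s) = [seq (map h p.1, map h p.2) | p <- splits s].
Proof. by elim: s => //= x s ->; rewrite map_cat -!map_comp. Qed.

Lemma Forall_splits (T : Type) (P : T -> Prop) (s : seq T) : List.Forall P s ->
  List.Forall (fun p => List.Forall P p.1 /\ List.Forall P p.2) (splits s).
Proof.
elim: s => [|x s IH] /=; first by constructor.
move=> /List.Forall_cons_iff[Px /IH Ps]; apply/List.Forall_app; split;
  by apply/List.Forall_map; apply: List.Forall_impl Ps => p [] /=; split => //; constructor.
Qed.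

Variable (T : eqType) (V : nmodType).

Lemma sum_splits_catr (Phi : seq T -> seq T -> V) (x : T) (s1 s2 : seq T) :
  (forall a a' b b', perm_eq a a' -> perm_eq b b' -> Phi a b = Phi a' b') ->
  \sum_(p <- splits (s1 ++ x :: s2)) Phi p.1 p.2 =
  \sum_(p <- splits (x :: s1 ++ s2)) Phi p.1 p.2.
Proof.
elim: s1 Phi => [//|y s1 IH] Phi pPhi /=.
rewrite !big_cat !big_map /= !big_cat !big_map /=.
rewrite (IH (fun a b => Phi (y :: a) b)); last first.
  by move=> a a' b b' pa pb; apply: pPhi => //; rewrite perm_cons.
rewrite (IH (fun a b => Phi a (y :: b))); last first.
  by move=> a a' b b' pa pb; apply: pPhi => //; rewrite perm_cons.
rewrite /= !big_cat !big_map /=.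
rewrite (eq_bigr (fun p => Phi [:: x, y & p.1] p.2)); last first.
  by move=> p _; apply: pPhi => //; apply/permP => P /=; rewrite addnCA.
rewrite [in X in _ + _ + (_ + X)](eq_bigr (fun p => Phi p.1 [:: x, y & p.2])); last first.
  by move=> p _; apply: pPhi => //; apply/permP => P /=; rewrite addnCA.
by rewrite -!addrA; congr (_ + _); rewrite addrCA.
Qed.

(** [splits] follows the order of the list; this invariance is what makes a split operator produce
    functions on configurations. The head of [s] is located in [s'] and moved to the front by
    [sum_splits_catr]. *)
Lemma sum_splits_perm (Phi : seq T -> seq T -> V) (s s' : seq T) :
  (forall a a' b b', perm_eq a a' -> perm_eq b b' -> Phi a b = Phi a' b') ->
  perm_eq s s' ->
  \sum_(p <- splits s) Phi p.1 p.2 = \sum_(p <- splits s') Phi p.1 p.2.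
Proof.
elim: s s' Phi => [|x s IH] s' Phi pPhi.
  by rewrite perm_sym => /perm_nilP->.
move=> xss'.
have xs' : x \in s' by rewrite -(perm_mem xss') mem_head.
case/splitPr: xs' xss' => s1 s2 xss'; rewrite sum_splits_catr//.
have ss' : perm_eq s (s1 ++ s2) by rewrite -(perm_cons x) (permPl xss') perm_catC/= perm_cons perm_catC.
rewrite /= !big_cat !big_map/=; congr (_ + _).
  by apply: (IH _ (fun a b => Phi (x :: a) b)) => // a a' b b' pa pb; apply: pPhi => //; rewrite perm_cons.
by apply: (IH _ (fun a b => Phi a (x :: b))) => // a a' b b' pa pb; apply: pPhi => //; rewrite perm_cons.
Qed.

End Splits.

Lemma sum_triangle (V : nmodType) (t : nat -> nat -> V) M :
  \sum_(N < M) \sum_(j < N.+1) t j (N - j)%N = \sum_(j < M) \sum_(k < M - j) t j k.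
Proof.
elim: M => [|M IH]; first by rewrite !big_ord0.
rewrite big_ord_recr /= IH.
transitivity (\sum_(j < M.+1) (\sum_(k < M - j) t j k + t j (M - j)%N)).
  by rewrite big_split /= [in RHS]big_ord_recr/= subnn big_ord0 addr0.
apply: eq_bigr => j _; rewrite subSn; last by rewrite -ltnS.
by rewrite big_ord_recr.
Qed.

(** * Integrals of sums over splittings *)

Section SplitIntegral.
Variables (R : realType) (d : nat).
Local Notation point := 'rV[R]_d.
Local Notation config := (config R d).

Lemma measurable_sum_Forall dW (W : measurableType dW) (I : Type) (s : seq I)
    (h : I -> W -> R) : List.Forall (fun i => measurable_fun setT (h i)) s ->
  measurable_fun setT (fun w => \sum_(i <- s) h i w).
Proof.
elim: s => [|i s IH].
  by move=> _; under eq_fun do rewrite big_nil; exact: measurable_cst.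
move=> /List.Forall_cons_iff[mi ms]; under eq_fun do rewrite big_cons.
by apply: measurable_funD => //; exact: IH.
Qed.

Lemma emeasurable_sum_Forall dW (W : measurableType dW) (I : Type) (s : seq I)
    (h : I -> W -> \bar R) : List.Forall (fun i => measurable_fun setT (h i)) s ->
  measurable_fun setT (fun w => \sum_(i <- s) h i w)%E.
Proof.
elim: s => [|i s IH].
  by move=> _; under eq_fun do rewrite big_nil; exact: measurable_cst.
move=> /List.Forall_cons_iff[mi ms]; under eq_fun do rewrite big_cons.
by apply: emeasurable_funD => //; exact: IH.
Qed.

Definition kmeas (f : point -> point -> R) :=
  forall dW (W : measurableType dW) (p q : W -> point),
  mrow p -> mrow q -> measurable_fun setT (fun w => f (p w) (q w)).

Lemma measurable_elam (f : point -> point -> R) dW (W : measurableType dW)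
    (p : W -> point) (l : seq (W -> point)) :
  kmeas f -> mrow p -> List.Forall (@mrow _ _ _ W) l ->
  measurable_fun setT (fun w => elam (f (p w)) [seq q w | q <- l]).
Proof.
move=> mf mp; rewrite /elam; elim: l => [|q l IH].
  by move=> _; under eq_fun do rewrite big_nil; exact: measurable_cst.
move=> /List.Forall_cons_iff[mq ml]; under eq_fun do rewrite big_cons.
by apply: measurable_funM; [exact: mf|exact: IH].
Qed.

Lemma elam_cons (f : point -> R) x s : elam f (x :: s) = f x * elam f s.
Proof. by rewrite /elam big_cons. Qed.

Lemma elam_ge0 (f : point -> R) s : (forall x, 0 <= f x) -> 0 <= elam f s.
Proof. by move=> f0; apply: prodr_ge0. Qed.

Lemma elam_perm (f : point -> R) s s' : perm_eq s s' -> elam f s = elam f s'.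
Proof. by move=> ss'; apply: perm_big. Qed.

Section OneBody.
Variables (psi : point -> R) (b : R).
Hypotheses (psi0 : forall x, 0 <= psi x) (mpsi : rmeas (fun x => (psi x)%:E)).
Hypothesis psib : intRd (fun x => (psi x)%:E) = b%:E.

Lemma cmeas_sum_splits (a : nat -> nat -> R) (u : config -> \bar R) : cmeas u ->
  cmeas (fun eta => \sum_(p <- splits eta)
     (a (size p.1) (size p.2) * elam psi p.2)%:E * u p.1)%E.
Proof.
move=> mu dW W l ml; under eq_fun do rewrite splits_map big_map/=.
apply: emeasurable_sum_Forall; apply: List.Forall_impl (Forall_splits ml) => q [m1 m2].
apply: emeasurable_funM; last exact: mu.
under eq_fun do rewrite !size_map EFinM; apply: emeasurable_funM => //.
apply/measurable_EFinP; apply: (@measurable_elam (fun _ => psi) _ _ (fun=> 0)) => //.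
  by move=> dV V p p' _ mp'; apply/measurable_EFinP; exact: mpsi.
Qed.

(** Fixed-cardinality form of the Lebesgue-Poisson rule that turns the integral of a sum over xi and
    eta \ xi into a double integral: every point of eta \ xi integrates to [b]. The coefficients [a]
    and the function [u] are arbitrary so that the induction can modify them: the first point either
    joins xi, which shifts [a] in its first argument and fixes a point of [u], or joins the
    complement, which shifts the second argument and contributes [psi y]. *)
Lemma int_conf_splits N (a : nat -> nat -> R) (u : config -> \bar R) :
  (forall j k, 0 <= a j k) -> (forall eta, 0 <= u eta)%E -> cmeas u ->
  int_conf N (fun eta => \sum_(p <- splits eta)
     (a (size p.1) (size p.2) * elam psi p.2)%:E * u p.1)%E =
  (\sum_(j < N.+1) ('C(N, j)%:R * a j (N - j)%N * b ^+ (N - j))%:E * int_conf j u)%E.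
Proof.
have b0 : 0 <= b by rewrite -lee_fin -psib; apply: intRd_ge0 => x; rewrite lee_fin.
elim: N a u => [|N IH] a u a0 u0 mu.
  rewrite int_conf0 /= big_seq1 big_ord_recl big_ord0 adde0/=.
  by rewrite /elam big_nil bin0 subnn expr0 mul1r.
have mcons y : cmeas (fun eta => u (y :: eta)).
  move=> dW W l ml; apply: (mu _ _ ((fun=> y) :: l)); constructor => //; exact: mrow_cst.
have sp0 a' (u' : config -> \bar R) eta : (forall j k, 0 <= a' j k) -> (forall eta, 0 <= u' eta)%E ->
    (0 <= \sum_(p <- splits eta) (a' (size p.1) (size p.2) * elam psi p.2)%:E * u' p.1)%E.
  move=> a'0 u'0; apply: sume_ge0 => p _; apply: mule_ge0 => //.
  by rewrite lee_fin mulr_ge0// elam_ge0.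
rewrite int_confS.
transitivity (intRd (fun y : point =>
   \sum_(j < N.+1) ('C(N, j)%:R * a j.+1 (N - j)%N * b ^+ (N - j))%:E *
                   int_conf j (fun eta => u (y :: eta)) +
   (\sum_(j < N.+1) ('C(N, j)%:R * a j (N - j).+1 * b ^+ (N - j))%:E * int_conf j u) *
     (psi y)%:E)%E).
  apply: eq_intRd => y.
  rewrite -(IH (fun j k => a j.+1 k) (fun eta => u (y :: eta)))//.
  rewrite -(IH (fun j k => a j k.+1) u)// muleC -int_confZ//; first last.
  - exact: (@cmeas_sum_splits (fun j k => a j k.+1) u).
  - by move=> eta; exact: (sp0 (fun j k => a j k.+1)).
  - by rewrite lee_fin.
  rewrite -int_confD; first last.
  - move=> dW W l ml; apply: emeasurable_funM => //.
    exact: (@cmeas_sum_splits (fun j k => a j k.+1) u).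
  - exact: (@cmeas_sum_splits (fun j k => a j.+1 k) (fun eta => u (y :: eta))).
  - move=> eta; apply: mule_ge0; first by rewrite lee_fin.
    exact: (sp0 (fun j k => a j k.+1)).
  - by move=> eta; exact: (sp0 (fun j k => a j.+1 k) (fun eta => u (y :: eta))).
  apply: eq_int_conf => eta _; rewrite /= big_cat !big_map/=; congr (_ + _)%E.
  rewrite ge0_sume_distrr//; last first.
    by move=> p _; apply: mule_ge0 => //; rewrite lee_fin mulr_ge0// elam_ge0.
  apply: eq_bigr => p _; rewrite elam_cons muleA -EFinM; congr (_%:E * _)%E.
  by rewrite mulrCA mulrA.
have mI j : rmeas (fun y => int_conf j (fun eta => u (y :: eta))).
  move=> dW W p mp; apply: (@measurable_int_conf _ _ _ _ _ (fun w eta => u (p w :: eta))).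
  move=> dV V q l mq ml; apply: (mu _ _ ((p \o q) :: l)); constructor => //.
  exact: mrow_comp.
have cf0 j : 0 <= 'C(N, j)%:R * a j.+1 (N - j)%N * b ^+ (N - j).
  by rewrite !mulr_ge0// exprn_ge0.
have cf1 j : 0 <= 'C(N, j)%:R * a j (N - j).+1 * b ^+ (N - j).
  by rewrite !mulr_ge0// exprn_ge0.
rewrite intRdD; first last.
- by move=> dW W p mp; apply: emeasurable_funM => //; exact: mpsi.
- move=> dW W p mp; apply: emeasurable_sum => j; apply: emeasurable_funM => //.
  exact: mI.
- move=> y; apply: mule_ge0; last by rewrite lee_fin.
  by apply: sume_ge0 => j _; apply: mule_ge0; [rewrite lee_fin|exact: int_conf_ge0].
- by move=> y; apply: sume_ge0 => j _; apply: mule_ge0; [rewrite lee_fin|exact: int_conf_ge0].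
rewrite intRd_sum; first last.
- by move=> j dW W p mp; apply: emeasurable_funM => //; exact: mI.
- by move=> j y; apply: mule_ge0; [rewrite lee_fin|exact: int_conf_ge0].
rewrite intRdZ//; first last.
  by apply: sume_ge0 => j _; apply: mule_ge0; [rewrite lee_fin|exact: int_conf_ge0].
rewrite psib muleC ge0_sume_distrr; last first.
  by move=> j _; apply: mule_ge0; [rewrite lee_fin|exact: int_conf_ge0].
pose r j := (('C(N, j)%:R * a j (N.+1 - j)%N * b ^+ (N.+1 - j))%:E * int_conf j u)%E.
transitivity (\sum_(j < N.+1) ('C(N, j)%:R * a j.+1 (N - j)%N * b ^+ (N - j))%:E * int_conf j.+1 u
   + \sum_(j < N.+1) r j)%E.
  congr (_ + _)%E; apply: eq_bigr => j _.
    by rewrite intRdZ// ?lee_fin//; [congr (_ * _)%E; rewrite int_confS|move=> y; exact: int_conf_ge0].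
  rewrite muleA -EFinM /r subSn; last by rewrite -ltnS.
  by congr (_%:E * _)%E; rewrite exprS; ring.
rewrite [RHS]big_ord_recl/=.
(* The added term j = N+1 vanishes with its binomial coefficient; it aligns the two sums for
   Pascal's rule. *)
have -> : (\sum_(j < N.+1) r j = \sum_(j < N.+2) r j)%E.
  by rewrite [RHS]big_ord_recr/= /r bin_small// !mul0r mul0e adde0.
rewrite [X in (_ + X)%E = _]big_ord_recl/= addeCA; congr (_ + _)%E; first by rewrite /r !bin0.
rewrite -big_split/=; apply: eq_bigr => j _.
rewrite /r /bump/= !add1n subSS -ge0_muleDl ?lee_fin//; last first.
  by rewrite !mulr_ge0// exprn_ge0.
by rewrite -EFinD; congr (_%:E * _)%E; rewrite binS natrD; ring.
Qed.

End OneBody.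

End SplitIntegral.

(** * Split operators, weighted norms and the basic norm inequality *)

Section SplitOperator.
Variables (R : realType) (d : nat).
Local Notation point := 'rV[R]_d.
Local Notation config := (config R d).
Implicit Types (f g : point -> point -> R) (G H : config -> R).

Definition kernel_term f g G (p : config * config) (x : point) : R :=
  elam (f x) p.1 * elam (g x) p.2 * G (rcons p.1 x).

(** Common form of both gain terms: [L2eps] has f = e^(-eps phi) and g = (e^(-eps phi) - 1) / eps,
    while [L2V] has f = 1 and g = -phi. *)
Definition splitop (z : R) f g G : config -> R := fun eta =>
  z * \sum_(p <- splits eta) fine (intRd (fun x => (kernel_term f g G p x)%:E)).

Lemma measurable_kernel_term f g G dW (W : measurableType dW) (p : W -> point)
    (l1 l2 : seq (W -> point)) :
  kmeas f -> kmeas g -> conf_fun G -> mrow p ->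
  List.Forall (@mrow _ _ _ W) l1 -> List.Forall (@mrow _ _ _ W) l2 ->
  measurable_fun setT
    (fun w => kernel_term f g G ([seq q w | q <- l1], [seq q w | q <- l2]) (p w)).
Proof.
move=> mf mg cG mp ml1 ml2; rewrite /kernel_term/=.
apply: measurable_funM.
  by apply: measurable_funM; exact: measurable_elam.
under eq_fun do rewrite -(map_rcons (fun q => q _)).
apply: measurable_conf_fun => //; rewrite -cats1; apply/List.Forall_app; split => //.
by repeat constructor.
Qed.

Lemma Forall_mrow_comp dW (W : measurableType dW) dV (V : measurableType dV)
    (l : seq (W -> point)) (q : V -> W) : measurable_fun setT q ->
  List.Forall (@mrow _ _ _ W) l -> List.Forall (@mrow _ _ _ V) [seq p \o q | p <- l].
Proof.
move=> mq ml; apply/List.Forall_map; apply: List.Forall_impl ml => p mp.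
exact: mrow_comp.
Qed.

Lemma Forall_mrow_cst dW (W : measurableType dW) (s : config) :
  List.Forall (@mrow _ _ _ W) [seq (fun=> x) | x <- s].
Proof. by elim: s => [|x s IH] /=; constructor => //; exact: mrow_cst. Qed.

Lemma rmeas_kernel_term f g G p : kmeas f -> kmeas g -> conf_fun G ->
  rmeas (fun x => (kernel_term f g G p x)%:E).
Proof.
case: p => p1 p2 mf mg cG dW W p mp; apply/measurable_EFinP.
have := measurable_kernel_term mf mg cG mp (Forall_mrow_cst W p1) (Forall_mrow_cst W p2).
congr measurable_fun; apply/funext => w; rewrite -!map_comp /comp.
by rewrite !map_id.
Qed.

Lemma kernel_term_perm f g G a a' b b' : conf_fun G -> perm_eq a a' -> perm_eq b b' ->
  kernel_term f g G (a, b) =1 kernel_term f g G (a', b').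
Proof.
move=> [pG _] aa' bb' x; rewrite /kernel_term/=.
rewrite (elam_perm _ aa') (elam_perm _ bb'); congr (_ * _); apply: pG.
by rewrite -!cats1 perm_cat2r.
Qed.

Lemma splitop_conf_fun z f g G : kmeas f -> kmeas g -> conf_fun G ->
  conf_fun (splitop z f g G).
Proof.
move=> mf mg cG; apply: conf_funP => [eta eta' ee'|dW W l ml].
  congr (z * _).
  apply: (sum_splits_perm (Phi := fun a b =>
    fine (intRd (fun x => (kernel_term f g G (a, b) x)%:E)))) => // a a' b b' aa' bb'.
  by congr fine; apply: eq_intRd => x; rewrite (kernel_term_perm f g cG aa' bb').
apply: measurable_funM => //; under eq_fun do rewrite splits_map big_map.
apply: measurable_sum_Forall; apply: List.Forall_impl (Forall_splits ml) => q [m1 m2].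
apply: (measurableT_comp (fine_measurable measurableT)).
apply: (@measurable_intRd _ _ _ _ (fun w x => (kernel_term f g G
  ([seq r w | r <- q.1], [seq r w | r <- q.2]) x)%:E)) => dV V r p mr mp.
apply/measurable_EFinP.
have := measurable_kernel_term mf mg cG mp (Forall_mrow_comp mr m1) (Forall_mrow_comp mr m2).
by congr measurable_fun; apply/funext => v; rewrite -!map_comp.
Qed.

(** General weights in place of C^n: the generator costs a factor n, truncations and Euler steps
    multiply by functions of |eta|, and all of these can be absorbed into the weight, so that norm
    estimates become inequalities between sequences. *)
Definition wnorm (w : nat -> R) G : \bar R :=
  (\sum_(0 <= n <oo) ((w n / (n`!)%:R)%R%:E * int_conf n (fun eta => (`|G eta|)%:E)))%E.

Lemma normCE C G : normC C G = wnorm (fun n => C ^+ n) G. Proof. by []. Qed.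

Lemma cmeas_norm G : conf_fun G -> cmeas (fun eta => (`|G eta|)%:E).
Proof.
move=> cG dW W l ml; apply/measurable_EFinP.
by apply: measurableT_comp => //; exact: measurable_conf_fun.
Qed.

Section PairPotential.
Variables (phi : point -> R) (b : R).
Hypotheses (phi0 : forall x, 0 <= phi x) (phiN : forall x, phi (- x) = phi x).
Hypotheses (bphi : borel_meas phi) (phib : intRd (fun x => (phi x)%:E) = b%:E).

Definition pair_pot (x y : point) : R := phi (x - y).

Lemma kmeas_pair_pot : kmeas pair_pot.
Proof.
by move=> dW W p q mp mq; apply: mrow_borel_meas => //; exact: mrowB.
Qed.

Definition unit_kernel (_ _ : point) : R := 1.

Lemma kmeas_unit_kernel : kmeas unit_kernel.
Proof. by move=> dW W p q _ _; exact: measurable_cst. Qed.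

Lemma elam_unit_kernel x s : elam (unit_kernel x) s = 1.
Proof. by rewrite /elam big1. Qed.

Lemma intRd_pair_pot x : intRd (fun y => (pair_pot x y)%:E) = b%:E.
Proof.
rewrite -phib -(@intRd_shift _ _ (fun y => (phi y)%:E) x).
- by apply: eq_intRd => y; rewrite /pair_pot -phiN opprB.
- by move=> y; rewrite lee_fin.
- by move=> dW W p mp; apply/measurable_EFinP; exact: mrow_borel_meas.
Qed.

(** With [a] equal to 1 this dominates a single kernel; with [a] affine in the two sizes it
    dominates a difference of kernels. *)
Definition majorant (a : nat -> nat -> R) G (p : config * config) (x : point) : R :=
  a (size p.1) (size p.2) * (kernel_term unit_kernel pair_pot (fun eta => `|G eta|) p x).

Lemma majorant_ge0 a G p x : (forall j k, 0 <= a j k) -> 0 <= majorant a G p x.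
Proof.
move=> a0; rewrite /majorant /kernel_term elam_unit_kernel mul1r !mulr_ge0//.
by apply: elam_ge0 => y; exact: phi0.
Qed.

Lemma conf_fun_abs G : conf_fun G -> conf_fun (fun eta => `|G eta|).
Proof.
move=> cG; apply: conf_funP => [eta eta' ee'|dW W l ml].
  by rewrite (cG.1 _ _ ee').
by apply: measurableT_comp => //; exact: measurable_conf_fun.
Qed.

Lemma rmeas_majorant a G p : conf_fun G -> rmeas (fun x => (majorant a G p x)%:E).
Proof.
move=> cG dW W q mq; under eq_fun do rewrite EFinM; apply: emeasurable_funM => //.
by apply: (rmeas_kernel_term _ kmeas_unit_kernel kmeas_pair_pot (conf_fun_abs cG)).
Qed.

(** Tonelli takes the integral over [x] outside, and symmetry of [G] moves [x] to the head of the
    list. There it counts as one more point of xi, which raises the order of the integral from j to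
    j+1. *)
Lemma int_conf_majorant N a G : (forall j k, 0 <= a j k) -> conf_fun G ->
  int_conf N (fun eta => \sum_(p <- splits eta)
     intRd (fun x => (majorant a G p x)%:E))%E =
  (\sum_(j < N.+1) ('C(N, j)%:R * a j (N - j)%N * b ^+ (N - j))%:E *
     int_conf j.+1 (fun eta => (`|G eta|)%:E))%E.
Proof.
move=> a0 cG; have caG := conf_fun_abs cG.
have b0 : 0 <= b by rewrite -lee_fin -phib; apply: intRd_ge0 => x; rewrite lee_fin.
transitivity (int_conf N (fun eta => intRd (fun x =>
    \sum_(p <- splits eta) (majorant a G p x)%:E))%E).
  apply: eq_int_conf => eta _; rewrite intRd_sum//.
  - by move=> p x; rewrite lee_fin majorant_ge0.
  - by move=> p; exact: rmeas_majorant.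
rewrite int_conf_intRd_swap; first last.
- move=> dW W l p ml mp; under eq_fun do rewrite splits_map big_map.
  apply: emeasurable_sum_Forall; apply: List.Forall_impl (Forall_splits ml) => q [m1 m2].
  under eq_fun do rewrite EFinM/= !size_map; apply: emeasurable_funM => //.
  apply/measurable_EFinP.
  exact: (measurable_kernel_term kmeas_unit_kernel kmeas_pair_pot caG mp m1 m2).
- by move=> eta x; apply: sume_ge0 => p _; rewrite lee_fin majorant_ge0.
have mcons x : cmeas (fun eta => (`|G (x :: eta)|)%:E).
  move=> dW W l ml; apply: (cmeas_norm cG (l := (fun=> x) :: l)).
  by constructor => //; exact: mrow_cst.
transitivity (intRd (fun x => \sum_(j < N.+1)
   ('C(N, j)%:R * a j (N - j)%N * b ^+ (N - j))%:E *
     int_conf j (fun eta => (`|G (x :: eta)|)%:E))%E).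
  apply: eq_intRd => x.
  rewrite -(@int_conf_splits _ _ (pair_pot x) b _ _ _ _ a (fun eta => (`|G (x :: eta)|)%:E))//.
  - apply: eq_int_conf => eta _; apply: eq_bigr => p _.
    rewrite /majorant /kernel_term elam_unit_kernel mul1r mulrA EFinM; congr (_ * (`|_|)%:E)%E.
    by apply: cG.1; rewrite perm_rcons.
  - by move=> y; exact: phi0.
  - by move=> dW W p mp; apply/measurable_EFinP; apply: kmeas_pair_pot => //; exact: mrow_cst.
  - exact: intRd_pair_pot.
have cf j : 0 <= 'C(N, j)%:R * a j (N - j)%N * b ^+ (N - j).
  by rewrite !mulr_ge0// exprn_ge0.
have i0 j x : (0 <= int_conf j (fun eta => (`|G (x :: eta)|)%:E))%E.
  by apply: int_conf_ge0 => eta; rewrite lee_fin.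
have mI j : rmeas (fun x => int_conf j (fun eta => (`|G (x :: eta)|)%:E)).
  move=> dW W p mp.
  apply: (@measurable_int_conf _ _ _ _ _ (fun w eta => (`|G (p w :: eta)|)%:E)).
  move=> dV V q l mq ml; apply: (cmeas_norm cG (l := (p \o q) :: l)); constructor => //.
  exact: mrow_comp.
rewrite intRd_sum; first last.
- by move=> j dW W p mp; apply: emeasurable_funM => //; exact: mI.
- by move=> j x; apply: mule_ge0 => //; rewrite lee_fin.
by apply: eq_bigr => j _; rewrite intRdZ// ?lee_fin// int_confS.
Qed.

(* The factorials come from counting the splittings of a configuration of size
   [j + k] into parts of sizes [j] and [k]. *)
Lemma wnorm_majorant (w v : nat -> R) (a : nat -> nat -> R) (z : R) G H :
  0 <= z -> (forall n, 0 <= w n) -> (forall n, 0 <= v n) -> (forall j k, 0 <= a j k) ->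
  conf_fun G -> conf_fun H ->
  (forall j K, \sum_(k < K) z * (w (j + k)%N * a j k * b ^+ k / (j`!%:R * k`!%:R))
     <= v j.+1 / (j.+1)`!%:R) ->
  (forall eta, (`|H eta|%:E <= z%:E * \sum_(p <- splits eta)
     intRd (fun x => (majorant a G p x)%:E))%E) ->
  (wnorm w H <= wnorm v G)%E.
Proof.
move=> z0 w0 v0 a0 cG cH hwv hH.
have b0 : 0 <= b by rewrite -lee_fin -phib; apply: intRd_ge0 => x; rewrite lee_fin.
have I0 n : (0 <= int_conf n (fun eta => (`|G eta|)%:E))%E.
  by apply: int_conf_ge0 => eta; rewrite lee_fin.
have sm : cmeas (fun eta => \sum_(p <- splits eta)
     intRd (fun x => (majorant a G p x)%:E))%E.
  move=> dW W l ml; under eq_fun do rewrite splits_map big_map.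
  apply: emeasurable_sum_Forall; apply: List.Forall_impl (Forall_splits ml) => q [m1 m2].
  apply: (@measurable_intRd _ _ _ _ (fun w x => (majorant a G
    ([seq r w | r <- q.1], [seq r w | r <- q.2]) x)%:E)) => dV V r p mr mp.
  under eq_fun do rewrite EFinM/= !size_map; apply: emeasurable_funM => //.
  apply/measurable_EFinP.
  have := measurable_kernel_term kmeas_unit_kernel kmeas_pair_pot (conf_fun_abs cG) mp
    (Forall_mrow_comp mr m1) (Forall_mrow_comp mr m2).
  by congr measurable_fun; apply/funext => u; rewrite -!map_comp.
have s0 eta : (0 <= \sum_(p <- splits eta) intRd (fun x => (majorant a G p x)%:E))%E.
  by apply: sume_ge0 => p _; apply: intRd_ge0 => x; rewrite lee_fin majorant_ge0.
have JN N : (int_conf N (fun eta => (`|H eta|)%:E) <= z%:E *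
    \sum_(j < N.+1) ('C(N, j)%:R * a j (N - j)%N * b ^+ (N - j))%:E *
     int_conf j.+1 (fun eta => (`|G eta|)%:E))%E.
  rewrite -int_conf_majorant// -int_confZ ?lee_fin//.
  apply: le_int_conf => //.
  - exact: cmeas_norm.
  - by move=> dW W l ml; apply: emeasurable_funM => //; exact: sm.
rewrite /wnorm; apply: lime_le.
  by apply: is_cvg_nneseries => n _ _; rewrite mule_ge0 ?lee_fin ?divr_ge0//;
     apply: int_conf_ge0 => eta; rewrite lee_fin.
apply: nearW => M; rewrite big_mkord.
pose c j k := z * (w (j + k)%N * a j k * b ^+ k / (j`!%:R * k`!%:R)).
have c0 j k : 0 <= c j k by rewrite /c !mulr_ge0// ?exprn_ge0// invr_ge0 mulr_ge0.
apply: (@le_trans _ _ (\sum_(N < M) \sum_(j < N.+1)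
    (c j (N - j)%N)%:E * int_conf j.+1 (fun eta => (`|G eta|)%:E))%E).
  apply: lee_sum => N _.
  apply: le_trans (lee_wpmul2l _ (JN N)) _; first by rewrite lee_fin divr_ge0.
  rewrite muleA -EFinM ge0_sume_distrr; last first.
    by move=> j _; rewrite mule_ge0// lee_fin !mulr_ge0// exprn_ge0.
  apply: lee_sum => j _; rewrite muleA -EFinM.
  have jN : (j <= N)%N by rewrite -ltnS.
  rewrite le_eqVlt; apply/orP; left; apply/eqP; congr (_%:E * _)%E.
  rewrite /c subnKC// -(bin_fact jN) !natrM; field.
  by rewrite !pnatr_eq0 -!lt0n !fact_gt0 bin_gt0 jN.
rewrite (sum_triangle (fun j k =>
  (c j k)%:E * int_conf j.+1 (fun eta => (`|G eta|)%:E))%E).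
apply: (@le_trans _ _ (\sum_(j < M) (v j.+1 / (j.+1)`!%:R)%:E *
    int_conf j.+1 (fun eta => (`|G eta|)%:E))%E).
  apply: lee_sum => j _; rewrite -ge0_sume_distrl; last first.
    by move=> k _; rewrite lee_fin.
  by rewrite lee_wpmul2r// sumEFin lee_fin; exact: hwv.
(* One more term is taken on the right because the indices are j+1; the term n = 0 is nonnegative
   and is dropped. *)
apply: le_trans (nneseries_lim_ge M.+1 _) => //; last first.
  by move=> n _ _; rewrite mule_ge0// lee_fin divr_ge0.
rewrite big_mkord big_ord_recl/= leeDr// mule_ge0// lee_fin divr_ge0//.
Qed.

End PairPotential.
End SplitOperator.

(** * Numerical inequalities *)

Section NumericBounds.
Variable R : realType.
Implicit Types (x u : R) (n j K : nat).

(** Follows from Bernoulli's inequality. Enlarging the norm parameter by the factor 1 + x pays for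
    one factor |eta|; it is used with x = 1, 1/2 and 1/3. *)
Lemma natr_le_expD x n : 0 <= x -> n%:R * x <= (1 + x) ^+ n.
Proof.
move=> x0; suff : 1 + n%:R * x <= (1 + x) ^+ n by apply: le_trans; rewrite lerDr.
elim: n => [|n IH]; first by rewrite mul0r addr0 expr0.
have n0 : 0 <= n%:R :> R by [].
rewrite exprS; apply: le_trans (ler_wpM2l _ IH); last by rewrite addr_ge0.
by rewrite -natr1; nra.
Qed.

Lemma sqrn_le_exp2 n : (n * n <= 2 ^ n.+1)%N.
Proof.
case: n => [//|[//|[//|n]]]; elim: n => [//|n IH].
by rewrite expnS; apply: leq_trans (leq_mul (leqnn 2) IH); nia.
Qed.

(** Halved, this is (j+1)(j+1/2) <= 2^(j+1), the weight inequality behind constant 1 in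
    [wnorm_splitopB]. The 1/2 is the second-order coefficient of the exponential; without it one
    would need (j+1)^2 <= 2^(j+1), which fails at j = 2. *)
Lemma triangular_le_exp2 j : (j.+1 * (2 * j).+1 <= 2 ^ j.+2)%N.
Proof.
case: j => [//|[//|j]]; elim: j => [//|j IH].
by rewrite expnS; apply: leq_trans (leq_mul (leqnn 2) IH); nia.
Qed.

Lemma sum_exp_coeff_le u K : 0 <= u -> \sum_(k < K) u ^+ k / k`!%:R <= expR u.
Proof.
move=> u0; rewrite -(big_mkord predT (fun k => u ^+ k / k`!%:R)).
apply: (nondecreasing_cvgn_le _ (is_cvg_series_exp_coeff u)).
by apply: nondecreasing_series => k _ _; exact: exp_coeff_ge0.
Qed.

Lemma sum_natr_exp_coeff_le u K : 0 <= u ->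
  \sum_(k < K) k%:R * (u ^+ k / k`!%:R) <= u * expR u.
Proof.
move=> u0; case: K => [|K]; first by rewrite big_ord0 mulr_ge0// expR_ge0.
rewrite big_ord_recl/= mul0r add0r.
apply: le_trans (ler_wpM2l u0 (sum_exp_coeff_le K u0)); rewrite mulr_sumr.
apply: ler_sum => k _; rewrite /bump/= add1n factS natrM exprS le_eqVlt.
apply/orP; left; apply/eqP; field.
by rewrite nat1r !pnatr_eq0 -lt0n fact_gt0.
Qed.

Lemma expR_ge_quadratic u : 0 <= u -> 1 + u + u ^+ 2 / 2 <= expR u.
Proof.
move=> u0; apply: le_trans (sum_exp_coeff_le 3 u0).
by rewrite 3!big_ord_recr big_ord0/= add0r expr0 expr1 !divr1.
Qed.

(** Inverts the lower bound for e^u, using (1 - u + u^2/2)(1 + u + u^2/2) = 1 + u^4/4 >= 1. *)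
Lemma expRN_le_quadratic u : 0 <= u -> expR (- u) <= 1 - u + u ^+ 2 / 2.
Proof.
move=> u0; have q := expR_ge_quadratic u0.
have p0 : 0 < 1 + u + u ^+ 2 / 2 by nra.
rewrite expRN -[leLHS]mul1r ler_pdivrMr ?expR_gt0//.
apply: (@le_trans _ _ ((1 - u + u ^+ 2 / 2) * (1 + u + u ^+ 2 / 2))).
  rewrite [leRHS](_ : _ = 1 + (u ^+ 2) ^+ 2 / 4); last by field.
  by rewrite lerDl divr_ge0// sqr_ge0.
by apply: ler_wpM2l => //; nra.
Qed.

Lemma expR_ge_double u : 0 <= u -> 2 * u <= expR u.
Proof. by move=> u0; apply: le_trans (expR_ge_quadratic u0); nra. Qed.

End NumericBounds.

(** * Calculus of weighted norms *)

Section WeightedNorm.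
Variables (R : realType) (d : nat).
Local Notation config := (config R d).
Implicit Types (w v : nat -> R) (F G H : config -> R).

Lemma int_conf_norm_ge0 n G : (0 <= int_conf n (fun eta => (`|G eta|)%:E))%E.
Proof. by apply: int_conf_ge0 => eta; rewrite lee_fin. Qed.

Let term_ge0 w G n : (forall n, 0 <= w n) ->
  (0 <= (w n / n`!%:R)%:E * int_conf n (fun eta => (`|G eta|)%:E))%E.
Proof. by move=> w0; rewrite mule_ge0 ?int_conf_norm_ge0// lee_fin divr_ge0. Qed.

Lemma wnorm_ge0 w G : (forall n, 0 <= w n) -> (0 <= wnorm w G)%E.
Proof. by move=> w0; apply: nneseries_ge0 => n _ _; exact: term_ge0. Qed.

Lemma le_wnorm w v G : (forall n, 0 <= w n) -> (forall n, w n <= v n) ->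
  (wnorm w G <= wnorm v G)%E.
Proof.
move=> w0 wv; apply: lee_nneseries => [n _ _|n _]; first exact: term_ge0.
by rewrite lee_wpmul2r ?int_conf_norm_ge0// lee_fin ler_wpM2r.
Qed.

Lemma wnormZ w (k : R) G : (forall n, 0 <= w n) ->
  wnorm (fun n => k * w n) G = (k%:E * wnorm w G)%E.
Proof.
move=> w0; rewrite /wnorm -nneseriesZl; last by move=> n _; exact: term_ge0.
by apply: eq_eseriesr => n _; rewrite muleA -EFinM mulrA.
Qed.

Lemma wnormD w v G : (forall n, 0 <= w n) -> (forall n, 0 <= v n) ->
  wnorm (fun n => w n + v n) G = (wnorm w G + wnorm v G)%E.
Proof.
move=> w0 v0; rewrite /wnorm -nneseriesD; last 2 first.
- by move=> n _ _; exact: term_ge0.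
- by move=> n _ _; exact: term_ge0.
apply: eq_eseriesr => n _; rewrite -ge0_muleDl ?lee_fin ?divr_ge0//.
by rewrite -EFinD mulrDl.
Qed.

Lemma wnorm_triangle w F G H : (forall n, 0 <= w n) ->
  conf_fun F -> conf_fun G -> conf_fun H ->
  (forall eta, `|F eta| <= `|G eta| + `|H eta|) ->
  (wnorm w F <= wnorm w G + wnorm w H)%E.
Proof.
move=> w0 cF cG cH FGH; rewrite /wnorm -nneseriesD; last 2 first.
- by move=> n _ _; exact: term_ge0.
- by move=> n _ _; exact: term_ge0.
apply: lee_nneseries => [n _ _|n _]; first exact: term_ge0.
rewrite -ge0_muleDr ?int_conf_norm_ge0// lee_wpmul2l ?lee_fin ?divr_ge0//.
have mD : cmeas (fun eta => (`|G eta|)%:E + (`|H eta|)%:E)%E.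
  by move=> dW W l ml; apply: emeasurable_funD; exact: cmeas_norm.
rewrite -int_confD; [|by move=> eta; rewrite lee_fin..|exact: cmeas_norm|exact: cmeas_norm].
apply: le_int_conf => //; first exact: cmeas_norm.
by move=> eta _; rewrite -EFinD lee_fin.
Qed.

Lemma wnorm_size w (th : nat -> R) F G : (forall n, 0 <= w n) -> (forall n, 0 <= th n) ->
  conf_fun F -> conf_fun G -> (forall eta, `|F eta| <= th (size eta) * `|G eta|) ->
  (wnorm w F <= wnorm (fun n => w n * th n)%R G)%E.
Proof.
move=> w0 th0 cF cG FG; apply: lee_nneseries => [n _ _|n _]; first exact: term_ge0.
rewrite [X in (_ <= X%:E * _)%E]mulrAC [X in (_ <= X * _)%E]EFinM -muleA lee_wpmul2l ?lee_fin ?divr_ge0//.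
rewrite -int_confZ ?lee_fin//; last exact: cmeas_norm.
apply: le_int_conf => //; first exact: cmeas_norm.
  by move=> dW W l ml; apply: emeasurable_funM => //; exact: cmeas_norm.
by move=> eta <-; rewrite -EFinM lee_fin.
Qed.

End WeightedNorm.

(** * Norm bounds for gain terms and for their differences *)

Section OperatorBounds.
Variables (R : realType) (d : nat).
Local Notation point := 'rV[R]_d.
Local Notation config := (config R d).
Implicit Types (f g : point -> point -> R) (F G H : config -> R).

Lemma elam_norm_le (h k : point -> R) s : (forall y, `|h y| <= k y) ->
  `|elam h s| <= elam k s.
Proof.
by move=> hk; rewrite /elam normr_prod; apply: ler_prod => y _; rewrite normr_ge0 hk.
Qed.

(** The factors are exchanged one at a time; each exchange costs [al] relative to the dominating
    product. *)
Lemma elam_dist_le (h h' k : point -> R) (al : R) s : 0 <= al ->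
  (forall y, `|h y| <= k y) -> (forall y, `|h' y| <= k y) ->
  (forall y, `|h y - h' y| <= al * k y) ->
  `|elam h s - elam h' s| <= al * (size s)%:R * elam k s.
Proof.
move=> al0 hk h'k hh'; elim: s => [|y s IH].
  by rewrite /elam !big_nil subrr normr0 mulr0 mul0r.
rewrite !elam_cons (_ : _ - _ = (h y - h' y) * elam h s + h' y * (elam h s - elam h' s)); last by ring.
apply: le_trans (ler_normD _ _) _; rewrite !normrM /= -natr1.
apply: (@le_trans _ _ (al * k y * elam k s + k y * (al * (size s)%:R * elam k s))); last first.
  by rewrite le_eqVlt; apply/orP; left; apply/eqP; ring.
by apply: lerD; apply: ler_pM => //; exact: elam_norm_le.
Qed.

(** [fine] is 0 at both infinities, so the bound also covers divergent integrals. *)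
Lemma abs_fine_le (x : \bar R) : (`|fine x|%:E <= `|x|)%E.
Proof. by case: x => [r| |] //=; rewrite ?normr0 ?leey. Qed.

Variables (phi : point -> R) (b : R).
Hypotheses (phi0 : forall x, 0 <= phi x) (phiN : forall x, phi (- x) = phi x).
Hypotheses (bphi : borel_meas phi) (phib : intRd (fun x => (phi x)%:E) = b%:E).

Let b0 : 0 <= b.
Proof. by rewrite -lee_fin -phib; apply: intRd_ge0 => x; rewrite lee_fin. Qed.

(** Shared by the rescaled kernels and the Vlasov kernels, with bounds independent of eps. *)
Definition admissible f g := [/\ kmeas f, kmeas g, forall x y, `|f x y| <= 1
  & forall x y, `|g x y| <= pair_pot phi x y].

Lemma kernel_term_le f g G p x : admissible f g ->
  `|kernel_term f g G p x| <=
  kernel_term (@unit_kernel R d) (pair_pot phi) (fun eta => `|G eta|) p x.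
Proof.
move=> [_ _ f1 gphi]; rewrite /kernel_term !normrM ler_wpM2r// ler_pM//.
  exact: elam_norm_le.
exact: elam_norm_le.
Qed.

Lemma kernel_term_dist_le f g f' g' (al ga : R) G p x : 0 <= al -> 0 <= ga ->
  admissible f g -> admissible f' g' ->
  (forall x y, `|f x y - f' x y| <= al) ->
  (forall x y, `|g x y - g' x y| <= ga * pair_pot phi x y) ->
  `|kernel_term f g G p x - kernel_term f' g' G p x| <=
  majorant phi (fun j k => al * j%:R + ga * k%:R) G p x.
Proof.
move=> al0 ga0 [_ _ f1 gphi] [_ _ f1' gphi'] ff' gg'.
rewrite /majorant /kernel_term -mulrBl normrM mulrA ler_wpM2r//.
rewrite elam_unit_kernel mul1r.
rewrite (_ : _ - _ = (elam (f x) p.1 - elam (f' x) p.1) * elam (g x) p.2 +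
  elam (f' x) p.1 * (elam (g x) p.2 - elam (g' x) p.2)); last by ring.
apply: le_trans (ler_normD _ _) _; rewrite !normrM mulrDl.
have u1 s : elam (fun _ : point => 1 : R) s = 1 by rewrite /elam big1.
apply: lerD; last rewrite -[leRHS]mul1r; apply: ler_pM => //.
- have := @elam_dist_le (f x) (f' x) (fun=> 1) al p.1 al0; rewrite u1 !mulr1; exact.
- exact: elam_norm_le.
- by have := @elam_norm_le (f' x) (fun=> 1) p.1; rewrite u1; apply.
- exact: elam_dist_le.
Qed.

Lemma splitop_majorant z f g G eta : 0 <= z -> admissible f g -> conf_fun G ->
  (`|splitop z f g G eta|%:E <= z%:E * \sum_(p <- splits eta)
     intRd (fun x => (majorant phi (fun _ _ => 1) G p x)%:E))%E.
Proof.
move=> z0 ad cG; have [mf mg _ _] := ad.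
rewrite /splitop normrM (ger0_norm z0) EFinM lee_wpmul2l ?lee_fin//.
apply: (@le_trans _ _ (\sum_(p <- splits eta)
   `|fine (intRd (fun x => (kernel_term f g G p x)%:E))|)%:E).
  by rewrite lee_fin ler_norm_sum.
rewrite -sumEFin; apply: lee_sum => p _; apply: le_trans (abs_fine_le _) _.
have mk := rmeas_kernel_term p mf mg cG.
apply: le_trans (abse_intRd_le mk) _; apply: le_intRd => //.
- by move=> dW W q mq; apply: measurableT_comp => //; exact: mk.
- exact: rmeas_majorant.
- by move=> x; rewrite lee_fin /majorant mul1r; exact: kernel_term_le.
Qed.

(* The summand [de] makes the right-hand side infinite as soon as one of
   the two integrals diverges, where [fine] returns a junk value; this avoids
   any almost-everywhere argument in [eta]. *)
Lemma splitopB_majorant z f g f' g' (al ga de : R) G eta :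
  0 <= z -> 0 <= al -> 0 <= ga -> 0 < de ->
  admissible f g -> admissible f' g' -> conf_fun G ->
  (forall x y, `|f x y - f' x y| <= al) ->
  (forall x y, `|g x y - g' x y| <= ga * pair_pot phi x y) ->
  (`|splitop z f g G eta - splitop z f' g' G eta|%:E <= z%:E * \sum_(p <- splits eta)
     intRd (fun x => (majorant phi (fun j k => al * j%:R + ga * k%:R + de) G p x)%:E))%E.
Proof.
move=> z0 al0 ga0 de0 ad ad' cG ff' gg'.
have [mf mg _ _] := ad; have [mf' mg' _ _] := ad'.
rewrite /splitop -mulrBr normrM (ger0_norm z0) EFinM lee_wpmul2l ?lee_fin//.
rewrite -sumrB.
apply: (@le_trans _ _ (\sum_(p <- splits eta) `|fine (intRd (fun x => (kernel_term f g G p x)%:E))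
   - fine (intRd (fun x => (kernel_term f' g' G p x)%:E))|)%:E).
  by rewrite lee_fin ler_norm_sum.
rewrite -sumEFin; apply: lee_sum => p _.
have mk := rmeas_kernel_term p mf mg cG.
have mk' := rmeas_kernel_term p mf' mg' cG.
pose a (j k : nat) := al * j%:R + ga * k%:R + de.
have a0 j k : 0 <= a j k.
  by apply: addr_ge0; [apply: addr_ge0; exact: mulr_ge0|exact: ltW].
have inf (h k : point -> point -> R) : admissible h k ->
    intRd (fun x => `|(kernel_term h k G p x)%:E|)%E = +oo%E ->
    intRd (fun x => (majorant phi a G p x)%:E) = +oo%E.
  move=> adh hinf; have [mh mk1 _ _] := adh.
  apply/eqP; rewrite -leye_eq.
  rewrite -(gt0_muley (x := de%:E)) ?lte_fin// -hinf -intRdZ//; last 2 first.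
  - by rewrite lee_fin ltW.
  - move=> dW W q mq; apply: measurableT_comp => //.
    exact: (rmeas_kernel_term p mh mk1 cG).
  apply: le_intRd.
  - by move=> x; rewrite mule_ge0// lee_fin ltW.
  - move=> dW W q mq; apply: emeasurable_funM => //; apply: measurableT_comp => //.
    exact: (rmeas_kernel_term p mh mk1 cG).
  - exact: rmeas_majorant.
  - move=> x; rewrite -EFinM lee_fin /majorant; apply: ler_pM => //; first exact: ltW.
      by rewrite /a lerDr addr_ge0// mulr_ge0.
    exact: kernel_term_le.
have [fi|] := ltP (intRd (fun x => `|(kernel_term f g G p x)%:E|)%E) +oo%E; last first.
  by rewrite leye_eq => /eqP /(inf _ _ ad) ->; rewrite leey.
have [fi'|] := ltP (intRd (fun x => `|(kernel_term f' g' G p x)%:E|)%E) +oo%E; last first.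
  by rewrite leye_eq => /eqP /(inf _ _ ad') ->; rewrite leey.
have fin (h : point -> \bar R) : rmeas h -> (intRd (fun x => `|h x|) < +oo)%E -> intRd h \is a fin_num.
  by move=> mh hi; rewrite fin_num_abs (le_lt_trans (abse_intRd_le mh)).
rewrite -fineB ?fin// -intRdB//; apply: le_trans (abs_fine_le _) _.
have mB : rmeas (fun x => (kernel_term f g G p x - kernel_term f' g' G p x)%:E).
  by move=> dW W q mq; exact: (emeasurable_funB (mk _ _ _ mq) (mk' _ _ _ mq)).
apply: le_trans (abse_intRd_le mB) _; apply: le_intRd => //.
- by move=> dW W q mq; apply: measurableT_comp => //; exact: mB.
- exact: rmeas_majorant.
- move=> x; rewrite lee_fin.
  apply: le_trans (kernel_term_dist_le G p x al0 ga0 ad ad' ff' gg') _.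
  rewrite /majorant ler_wpM2r//; last by rewrite /a lerDl ltW.
  rewrite /kernel_term elam_unit_kernel mul1r mulr_ge0// elam_ge0// => y.
  exact: phi0.
Qed.

(** Summing over the size k of eta \ xi gives e^(c b). The added point makes n = j+1, which accounts
    for the division by c and for the factor n. When z e^(c b) <= c the new weight is at most n c^n,
    the weight that the loss term [L1] produces. *)
Lemma wnorm_splitop (c z : R) f g G : 0 < c -> 0 <= z -> admissible f g -> conf_fun G ->
  (wnorm (fun n => c ^+ n)%R (splitop z f g G) <=
   wnorm (fun n => z * expR (c * b) / c * (n%:R * c ^+ n))%R G)%E.
Proof.
move=> c0 z0 ad cG; have [mf mg _ _] := ad.
apply: (wnorm_majorant phi0 phiN bphi phib (a := fun _ _ => 1) z0) => //.
- by move=> n; rewrite exprn_ge0// ltW.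
- by move=> n; rewrite !mulr_ge0 ?expR_ge0 ?invr_ge0 ?exprn_ge0// ltW.
- exact: splitop_conf_fun.
- move=> j K.
  have -> : z * expR (c * b) / c * (j.+1%:R * c ^+ j.+1) / j.+1`!%:R =
     z * c ^+ j / j`!%:R * expR (c * b).
    rewrite factS natrM exprS; field.
    by rewrite nat1r !pnatr_eq0 -!lt0n fact_gt0 gt_eqF.
  have cb : 0 <= c * b by rewrite mulr_ge0// ltW.
  apply: le_trans (ler_wpM2l _ (sum_exp_coeff_le K cb)); last first.
    by rewrite !mulr_ge0// ?invr_ge0// exprn_ge0// ltW.
  rewrite mulr_sumr; apply: ler_sum => k _; rewrite exprD exprMn le_eqVlt.
  apply/orP; left; apply/eqP; field.
  by rewrite !pnatr_eq0 -!lt0n !fact_gt0.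
- by move=> eta; exact: splitop_majorant.
Qed.

(** Each point of xi costs [al] and each point of its complement [al / 2]. After summation over k
    the two contributions carry z E <= C and z E C b <= C, where E = e^(C b); what remains is al
    (j+1)(j+1/2) C <= al 2^(j+1) C. *)
Lemma wnorm_splitopB (C z : R) f g f' g' (al : R) F : 0 < C -> 0 <= z -> 0 <= al ->
  z * expR (C * b) <= C -> z * expR (2 * C * b) <= 2 * C ->
  admissible f g -> admissible f' g' ->
  (forall x y, `|f x y - f' x y| <= al) ->
  (forall x y, `|g x y - g' x y| <= al / 2 * pair_pot phi x y) ->
  LC (2 * C) F ->
  (normC C (fun eta => splitop z f g F eta - splitop z f' g' F eta)%R <=
   al%:E * normC (2 * C) F)%E.
Proof.
move=> C0 z0 al0 zC z2C ad ad' ff' gg' [cF Ffin].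
have [mf mg _ _] := ad; have [mf' mg' _ _] := ad'.
have cB : conf_fun (fun eta => splitop z f g F eta - splitop z f' g' F eta).
  apply: conf_funP => [eta eta' ee'|dW W l ml].
    by rewrite ((splitop_conf_fun z mf mg cF).1 _ _ ee') ((splitop_conf_fun z mf' mg' cF).1 _ _ ee').
  by apply: measurable_funB; apply: measurable_conf_fun => //; exact: splitop_conf_fun.
have u0 : 0 <= C * b by rewrite mulr_ge0// ltW.
(* With u = C b: 2 u <= e^u gives 2 z e^u u <= z e^(2u) <= 2C. *)
have zu : z * expR (C * b) * (C * b) <= C.
  have e2 : expR (2 * C * b) = expR (C * b) * expR (C * b) by rewrite -expRD; congr expR; ring.
  have := expR_ge_double u0; have := expR_gt0 (C * b); move: z2C; rewrite e2.
  set E := expR _; set u := C * b in u0 * => h E0 uE.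
  have := ler_wpM2l (mulr_ge0 z0 (ltW E0)) uE; lra.
(* [de] is the auxiliary summand of [splitopB_majorant]; it is sent to 0, which is possible since
   the norm of [F] is finite. *)
suff H (de : R) : 0 < de -> (normC C (fun eta => splitop z f g F eta - splitop z f' g' F eta)%R <=
   (al + de)%:E * normC (2 * C) F)%E.
  move: Ffin H; have := wnorm_ge0 F (fun n => exprn_ge0 n (ltW (mulr_gt0 (ltr0Sn R 1) C0))).
  rewrite -normCE; case: (normC (2 * C) F) => [N| |]//; rewrite lee_fin => N0 _ H.
  apply/lee_addgt0Pr => e e0.
  have d0 : 0 < e / (N + 1) by rewrite divr_gt0// ltr_wpDl.
  apply: le_trans (H _ d0) _; rewrite -!EFinM -EFinD lee_fin mulrDl lerD2l.
  by rewrite mulrAC ler_pdivrMr ?ltr_wpDl// ler_pM2l// lerDl.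
move=> de0; rewrite !normCE -wnormZ; last first.
  by move=> n; rewrite exprn_ge0// mulr_ge0// ltW.
apply: (wnorm_majorant phi0 phiN bphi phib (z := z)
  (a := fun j k => al * j%:R + al / 2 * k%:R + de)) => //.
- by move=> n; rewrite exprn_ge0// ltW.
- by move=> n; apply: mulr_ge0; [rewrite addr_ge0// ltW|rewrite exprn_ge0// mulr_ge0// ltW].
- by move=> j k; rewrite !addr_ge0 ?mulr_ge0// ltW.
- move=> j K.
  pose t k := (C * b) ^+ k / k`!%:R.
  rewrite (eq_bigr (fun k : 'I_K => z * C ^+ j / j`!%:R *
      ((al * j%:R + de) * t k + al / 2 * (k%:R * t k)))); last first.
    move=> k _; rewrite /t exprD exprMn; field.
    by rewrite !pnatr_eq0 -!lt0n !fact_gt0.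
  rewrite -mulr_sumr big_split/= -!mulr_sumr.
  have s1 := sum_exp_coeff_le K u0; have s2 := sum_natr_exp_coeff_le K u0.
  set E := expR (C * b) in s1 s2 zu zC.
  apply: (@le_trans _ _ (z * C ^+ j / j`!%:R *
      ((al * j%:R + de) * E + al / 2 * (C * b * E)))).
    apply: ler_wpM2l; first by rewrite !mulr_ge0// ?invr_ge0// exprn_ge0// ltW.
    apply: lerD; apply: ler_wpM2l => //; first by rewrite addr_ge0 ?mulr_ge0// ltW.
    by rewrite divr_ge0.
  have fj : 0 < j`!%:R :> R by rewrite ltr0n fact_gt0.
  rewrite ler_pdivlMr ?ltr0n ?fact_gt0// factS natrM.
  rewrite [leLHS](_ : _ = C ^+ j * (al * (j.+1%:R * (z * E) * j%:R +
      j.+1%:R * (z * E * (C * b)) / 2) + de * (j.+1%:R * (z * E)))); last first.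
    by field; rewrite gt_eqF.
  rewrite exprMn [C ^+ j.+1]exprS [leRHS](_ : _ = C ^+ j * ((al + de) * 2 ^+ j.+1 * C)); last by ring.
  apply: ler_wpM2l; first by rewrite exprn_ge0// ltW.
  have j2 : j.+1%:R <= 2 ^+ j.+1 :> R.
    by have := natr_le_expD j.+1 (@ler01 R); rewrite mulr1.
  have t2 : j.+1%:R * (j%:R + 1 / 2) <= 2 ^+ j.+1 :> R.
    have := triangular_le_exp2 j; rewrite -(ler_nat R) natrM natrX exprS -[(2 * j).+1]addn1 natrD natrM.
    by move=> h; lra.
  have j0 : 0 <= j%:R :> R by [].
  have j10 : 0 <= j.+1%:R :> R by [].
  rewrite [leRHS](_ : _ = al * (2 ^+ j.+1 * C) + de * (2 ^+ j.+1 * C)); last by ring.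
  apply: lerD; apply: ler_wpM2l => //; last 2 first.
  - exact: ltW.
  - by apply: ler_pM => //; rewrite mulr_ge0// expR_ge0.
  have h1 : j.+1%:R * j%:R * (z * E) <= j.+1%:R * j%:R * C by rewrite ler_wpM2l// mulr_ge0.
  have h2 : j.+1%:R * (z * E * (C * b)) <= j.+1%:R * C by rewrite ler_wpM2l.
  by have := ler_wpM2r (ltW C0) t2; lra.
- by move=> eta; apply: splitopB_majorant => //; rewrite divr_ge0.
Qed.

End OperatorBounds.

(** * The space L_C with a real-valued norm *)

Section FunctionSpace.
Variables (R : realType) (d : nat).
Local Notation config := (config R d).
Implicit Types (F G H : config -> R).

Lemma conf_fun_lin a c F G : conf_fun F -> conf_fun G ->
  conf_fun (fun eta => a * F eta + c * G eta).
Proof.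
move=> cF cG; apply: conf_funP => [eta eta' ee'|dW W l ml].
  by rewrite (cF.1 _ _ ee') (cG.1 _ _ ee').
by apply: measurable_funD; apply: measurable_funM => //; exact: measurable_conf_fun.
Qed.

Lemma conf_fun_size (th : nat -> R) F : conf_fun F ->
  conf_fun (fun eta => th (size eta) * F eta).
Proof.
move=> cF; apply: conf_funP => [eta eta' ee'|dW W l ml].
  by rewrite (cF.1 _ _ ee') (perm_size ee').
under eq_fun do rewrite size_map.
by apply: measurable_funM => //; exact: measurable_conf_fun.
Qed.

Variable C : R.
Hypothesis C0 : 0 < C.

Let Cn0 n : 0 <= C ^+ n. Proof. by rewrite exprn_ge0// ltW. Qed.

(** The value is 0 when the norm is infinite, so this represents the norm only on [LC C]. *)
Definition nrm G : R := fine (normC C G).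

Lemma normC_ge0 G : (0 <= normC C G)%E. Proof. exact: wnorm_ge0. Qed.

Lemma nrm_ge0 G : 0 <= nrm G. Proof. by rewrite fine_ge0// normC_ge0. Qed.

Lemma nrm_le_normC G : ((nrm G)%:E <= normC C G)%E.
Proof. by rewrite /nrm; have := normC_ge0 G; case: (normC C G) => //= _; rewrite leey. Qed.

Lemma nrmE G : LC C G -> normC C G = (nrm G)%:E.
Proof. by move=> [_ fG]; rewrite fineK// ge0_fin_numE// normC_ge0. Qed.

Lemma normC_lin_le a c F G H : 0 <= a -> 0 <= c ->
  conf_fun F -> conf_fun G -> conf_fun H ->
  (forall eta, `|F eta| <= a * `|G eta| + c * `|H eta|) ->
  (normC C F <= a%:E * normC C G + c%:E * normC C H)%E.
Proof.
move=> a0 c0 cF cG cH FGH.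
have h (k : R) (K : config -> R) : 0 <= k -> conf_fun K ->
    (normC C (fun eta => k * K eta)%R <= k%:E * normC C K)%E.
  move=> k0 cK; rewrite normCE [in leRHS]normCE -wnormZ//.
  rewrite (_ : (fun n => k * C ^+ n) = fun n => C ^+ n * (fun=> k) n); last first.
    by apply/funext => n; rewrite mulrC.
  apply: (wnorm_size (th := fun=> k)) => //; first exact: (conf_fun_size (fun=> k) cK).
  by move=> eta; rewrite normrM ger0_norm.
apply: le_trans (leeD (h a G a0 cG) (h c H c0 cH)).
apply: wnorm_triangle => //; [exact: (conf_fun_size (fun=> a) cG)|exact: (conf_fun_size (fun=> c) cH)|].
by move=> eta; rewrite !normrM (ger0_norm a0) (ger0_norm c0).
Qed.

Lemma LC_lin_le a c F G H : 0 <= a -> 0 <= c -> conf_fun F -> LC C G -> LC C H ->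
  (forall eta, `|F eta| <= a * `|G eta| + c * `|H eta|) ->
  LC C F /\ nrm F <= a * nrm G + c * nrm H.
Proof.
move=> a0 c0 cF lG lH FGH; have := normC_lin_le a0 c0 cF lG.1 lH.1 FGH.
rewrite (nrmE lG) (nrmE lH) -!EFinM -EFinD => h.
have lF : LC C F by split => //; rewrite (le_lt_trans h)// ltry.
by split => //; rewrite -lee_fin -nrmE.
Qed.

Lemma LC_lin a c F G : LC C F -> LC C G -> LC C (fun eta => a * F eta + c * G eta).
Proof.
move=> lF lG; apply: (proj1 (LC_lin_le (normr_ge0 a) (normr_ge0 c) _ lF lG _)).
  exact: conf_fun_lin lF.1 lG.1.
by move=> eta; rewrite -!normrM ler_normD.
Qed.

Lemma LCB F G : LC C F -> LC C G -> LC C (fun eta => F eta - G eta).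
Proof.
move=> lF lG; have := LC_lin 1 (-1) lF lG.
by congr (LC C); apply/funext => eta; rewrite mul1r mulN1r.
Qed.

Lemma LCZ a F : LC C F -> LC C (fun eta => a * F eta).
Proof.
move=> lF; have := LC_lin a 0 lF lF.
by congr (LC C); apply/funext => eta; rewrite mul0r addr0.
Qed.

Lemma LCBBZ a F G H : LC C F -> LC C G -> LC C H ->
  LC C (fun eta => F eta - G eta - a * H eta).
Proof.
move=> lF lG lH; apply: LCB; first exact: LCB.
exact: LCZ.
Qed.

Lemma nrm_le1 F G : LC C F -> LC C G -> (forall eta, `|F eta| <= `|G eta|) ->
  nrm F <= nrm G.
Proof.
move=> lF lG FG.
have [|_] := LC_lin_le (@ler01 R) (lexx 0) lF.1 lG lG; last by rewrite mul1r mul0r addr0.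
by move=> eta; rewrite mul1r mul0r addr0.
Qed.

Lemma nrm_le2 a c F G H : 0 <= a -> 0 <= c -> LC C F -> LC C G -> LC C H ->
  (forall eta, `|F eta| <= a * `|G eta| + c * `|H eta|) ->
  nrm F <= a * nrm G + c * nrm H.
Proof. by move=> a0 c0 lF lG lH h; case: (LC_lin_le a0 c0 lF.1 lG lH h). Qed.

Lemma nrm_le3 F G1 G2 G3 : LC C F -> LC C G1 -> LC C G2 -> LC C G3 ->
  (forall eta, F eta = G1 eta + G2 eta + G3 eta) ->
  nrm F <= nrm G1 + nrm G2 + nrm G3.
Proof.
move=> lF l1 l2 l3 h.
have l12 := LC_lin 1 1 l1 l2.
apply: (@le_trans _ _ (1 * nrm (fun eta => 1 * G1 eta + 1 * G2 eta) + 1 * nrm G3)).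
  by apply: nrm_le2 => // eta; rewrite h !mul1r ler_normD.
rewrite !mul1r lerD2r -[nrm G1]mul1r -[nrm G2]mul1r.
by apply: nrm_le2 => // eta; rewrite !mul1r ler_normD.
Qed.

End FunctionSpace.

(** * Taylor estimates for contraction semigroups *)

Section Semigroup.
Variables (R : realType) (d : nat) (C : R).
Local Notation config := (config R d).
Hypothesis C0 : 0 < C.
Variable T : R -> (config -> R) -> config -> R.
Hypothesis sgT : C0_contraction_semigroup C T.
Implicit Types (F G H : config -> R).

Lemma sg_LC t F : 0 <= t -> LC C F -> LC C (T t F).
Proof. exact: (proj1 sgT). Qed.

Lemma sg_lin t a c F G : 0 <= t -> LC C F -> LC C G ->
  nrm C (fun eta => T t (fun xi => a * F xi + c * G xi) eta - (a * T t F eta + c * T t G eta)) = 0.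
Proof. by move=> t0 lF lG; rewrite /nrm (proj1 (proj2 sgT)). Qed.

Lemma sg_0 F : LC C F -> nrm C (fun eta => T 0 F eta - F eta) = 0.
Proof. by move=> lF; rewrite /nrm (proj1 (proj2 (proj2 sgT))). Qed.

Lemma sg_D t s F : 0 <= t -> 0 <= s -> LC C F ->
  nrm C (fun eta => T (t + s) F eta - T t (T s F) eta) = 0.
Proof. by move=> t0 s0 lF; rewrite /nrm (proj1 (proj2 (proj2 (proj2 sgT)))). Qed.

Lemma sg_contr t F : 0 <= t -> LC C F -> nrm C (T t F) <= nrm C F.
Proof.
move=> t0 lF; rewrite -lee_fin -!nrmE//; last exact: sg_LC.
exact: (proj1 (proj2 (proj2 (proj2 (proj2 sgT))))).
Qed.

(** Contractivity applied to F - G - a H. The axioms make [T t] linear only up to functions of norm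
    zero, so the corrections [S2] and [S3] are carried along explicitly. *)
Lemma sg_BBZ t a F G H : 0 <= t -> LC C F -> LC C G -> LC C H ->
  nrm C (fun eta => T t F eta - T t G eta - a * T t H eta) <=
  nrm C (fun eta => F eta - G eta - a * H eta).
Proof.
move=> t0 lF lG lH.
have l2 := LC_lin C0 1 a lG lH.
pose D xi := 1 * F xi + -1 * (1 * G xi + a * H xi).
have lD : LC C D by exact: LC_lin.
have -> : (fun eta => F eta - G eta - a * H eta) = D.
  by apply/funext => eta; rewrite /D; ring.
have := sg_contr t0 lD; apply: le_trans.
pose S2 eta := T t D eta - (1 * T t F eta + -1 * T t (fun xi => 1 * G xi + a * H xi) eta).
pose S3 eta := T t (fun xi => 1 * G xi + a * H xi) eta - (1 * T t G eta + a * T t H eta).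
have s2 : nrm C S2 = 0 by exact: sg_lin.
have s3 : nrm C S3 = 0 by exact: sg_lin.
have lS2 : LC C S2 by apply: LCB => //; [exact: sg_LC|apply: LC_lin => //; exact: sg_LC].
have lS3 : LC C S3 by apply: LCB => //; [exact: sg_LC|apply: LC_lin => //; exact: sg_LC].
rewrite -[leRHS]addr0 -{1}s2 -[leRHS]addr0 -{1}s3.
have -> : nrm C S2 = nrm C (fun eta => -1 * S2 eta).
  apply/le_anti/andP; split; apply: nrm_le1 => //; try exact: LCZ;
    by move=> eta; rewrite mulN1r normrN.
apply: nrm_le3 => //; try exact: LCZ.
- by apply: LCBBZ => //; exact: sg_LC.
- exact: sg_LC.
- by move=> eta; rewrite /S2 /S3; ring.
Qed.

Lemma sg_B t F G : 0 <= t -> LC C F -> LC C G ->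
  nrm C (fun eta => T t F eta - T t G eta) <= nrm C (fun eta => F eta - G eta).
Proof.
move=> t0 lF lG; have := sg_BBZ 0 t0 lF lG lG.
have e (K K' K'' : config -> R) : (fun eta => K eta - K' eta - 0 * K'' eta) =
  (fun eta => K eta - K' eta) by apply/funext => eta; rewrite mul0r subr0.
by rewrite !e.
Qed.

Lemma generator_near F H e : generator_graph C T F H -> 0 < e ->
  exists2 d0 : R, 0 < d0 & forall de, 0 < de -> de < d0 ->
    nrm C (fun eta => T de F eta - F eta - de * H eta) <= de * e.
Proof.
move=> [lF [lH cv]] e0.
have : nbhs (0 : \bar R) [set x | (x < e%:E)%E].
  by apply: (@open_nbhs_nbhs); split; [exact: open_ereal_lt_ereal|rewrite /= lte_fin].
move/cv; rewrite /at_right /within/= => /nbhs_ballP[d0 /= d00 hd]; exists d0 => // de de0 ded.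
have lQ : LC C (fun eta => (T de F eta - F eta) / de - H eta).
  apply: LCB => //; have := LCZ C0 de^-1 (LCB C0 (sg_LC (ltW de0) lF) lF).
  by congr (LC C); apply/funext => eta; rewrite mulrC.
have := hd de; rewrite /ball/= sub0r normrN gtr0_norm// => /(_ ded de0).
rewrite nrmE// lte_fin => /ltW h.
apply: le_trans (ler_wpM2l (ltW de0) h); rewrite -[leRHS]addr0 -[X in _ + X](mul0r (nrm C F)).
apply: nrm_le2 => //; first exact: ltW.
  by apply: LCBBZ => //; apply: sg_LC => //; exact: ltW.
move=> eta; rewrite mul0r addr0 -[X in X * `|_|](gtr0_norm de0) -normrM mulrBr mulrCA mulfV ?gt_eqF//.
by rewrite mulr1.
Qed.

(** Telescoping: by contractivity every increment over a step [de] is at most the first one. *)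
Lemma sg_subdivide F H e de k : 0 <= de -> LC C F -> LC C H ->
  nrm C (fun eta => T de F eta - F eta - de * H eta) <= de * e ->
  nrm C (fun eta => T (k%:R * de) F eta - F eta) <= k%:R * de * (nrm C H + e).
Proof.
move=> de0 lF lH h.
have lde := sg_LC de0 lF.
have h1 : nrm C (fun eta => T de F eta - F eta) <= de * (nrm C H + e).
  rewrite mulrDr addrC; apply: le_trans (lerD h (lexx _)); rewrite -[X in X + _]mul1r.
  apply: nrm_le2 => //; [exact: LCB|exact: LCBBZ|].
  move=> eta; rewrite mul1r -(ger0_norm de0) -normrM ger0_norm//.
  by apply: le_trans (ler_normD _ _); rewrite subrK.
elim: k => [|k IH]; first by rewrite !mul0r sg_0.
have k0 : 0 <= k%:R * de by rewrite mulr_ge0.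
rewrite -natr1 mulrDl mul1r [leRHS]mulrDl.
have lk := sg_LC k0 lF; have lkd := sg_LC (addr_ge0 k0 de0) lF; have lkk := sg_LC k0 lde.
apply: (@le_trans _ _ (nrm C (fun eta => T (k%:R * de + de) F eta - T (k%:R * de) (T de F) eta) +
  nrm C (fun eta => T (k%:R * de) (T de F) eta - T (k%:R * de) F eta) +
  nrm C (fun eta => T (k%:R * de) F eta - F eta))).
  apply: nrm_le3 => //; try exact: LCB.
  by move=> eta; ring.
rewrite sg_D// add0r addrC; apply: lerD => //; apply: le_trans h1; exact: sg_B.
Qed.

(** Subdivision replaces the formula T_h F - F = int_0^h T_s H ds: with steps so short that the
    difference quotient is within e / h of [H], the total error is at most e. *)
Lemma sg_gen1 F H h : generator_graph C T F H -> 0 <= h ->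
  nrm C (fun eta => T h F eta - F eta) <= h * nrm C H.
Proof.
move=> gF h0; have [lF [lH _]] := gF.
have [->|hn0] := eqVneq h 0; first by rewrite sg_0// mul0r.
have hp : 0 < h by rewrite lt_def hn0.
apply/ler_addgt0Pr => e e0.
have [d0 d00 hd] := generator_near gF (divr_gt0 e0 hp).
have [m m0 hm] : exists2 m : nat, (0 < m)%N & h / m%:R < d0.
  exists (Num.truncn (h / d0)).+1 => //.
  by rewrite ltr_pdivrMr ?ltr0n// mulrC -ltr_pdivrMr// truncnS_gt.
have mp : 0 < m%:R :> R by rewrite ltr0n.
have := sg_subdivide m (ltW (divr_gt0 hp mp)) lF lH (hd _ (divr_gt0 hp mp) hm).
by rewrite [_ * (h / _)]mulrC divfK ?gt_eqF// mulrDr [h * (e / h)]mulrC divfK.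
Qed.

(** Second-order Taylor estimate. Along the subdivision [T s H] is compared with [H] for s <= h, and
    [sg_gen1] bounds each such difference by h |H2|; this gives h^2 without the factor 1/2. *)
Lemma sg_gen2 F H H2 h : generator_graph C T F H -> generator_graph C T H H2 -> 0 <= h ->
  nrm C (fun eta => T h F eta - F eta - h * H eta) <= h * (h * nrm C H2).
Proof.
move=> gF gH h0; have [lF [lH _]] := gF; have [_ [lH2 _]] := gH.
have [->|hn0] := eqVneq h 0.
  have -> : (fun eta => T 0 F eta - F eta - 0 * H eta) = (fun eta => T 0 F eta - F eta).
    by apply/funext => eta; rewrite mul0r subr0.
  by rewrite sg_0// !mul0r.
have hp : 0 < h by rewrite lt_def hn0.
apply/ler_addgt0Pr => e e0.
have [d0 d00 hd] := generator_near gF (divr_gt0 e0 hp).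
have [m m0 hm] : exists2 m : nat, (0 < m)%N & h / m%:R < d0.
  exists (Num.truncn (h / d0)).+1 => //.
  by rewrite ltr_pdivrMr ?ltr0n// mulrC -ltr_pdivrMr// truncnS_gt.
have mp : 0 < m%:R :> R by rewrite ltr0n.
have dep := divr_gt0 hp mp; have {hd} := hd _ dep hm.
set de := h / m%:R in dep * => hd; have de0 := ltW dep.
have mde : m%:R * de = h by rewrite mulrC divfK ?gt_eqF.
have lde := sg_LC de0 lF.
suff H' k : (k <= m)%N -> nrm C (fun eta => T (k%:R * de) F eta - F eta - k%:R * de * H eta) <=
    k%:R * de * (e / h + h * nrm C H2).
  have := H' m (leqnn m); rewrite mde mulrDr [h * (e / h)]mulrC divfK//.
  by rewrite addrC.
elim: k => [|k IH] km.
  have -> : (fun eta => T (0%:R * de) F eta - F eta - 0%:R * de * H eta) =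
     (fun eta => T 0 F eta - F eta).
    by apply/funext => eta; rewrite !mul0r subr0.
  by rewrite sg_0// !mul0r.
have k0 : 0 <= k%:R * de by rewrite mulr_ge0.
have kh : k%:R * de <= h by rewrite -mde ler_wpM2r// ler_nat ltnW.
rewrite -natr1 mulrDl mul1r [leRHS]mulrDl.
have lk := sg_LC k0 lF; have lkd := sg_LC (addr_ge0 k0 de0) lF; have lkk := sg_LC k0 lde.
have lkH := sg_LC k0 lH.
(* The three parts are the semigroup law, of norm zero; [T (k de)] applied to the one-step
   remainder; and the previous remainder together with the drift of [H]. *)
apply: (@le_trans _ _ (nrm C (fun eta => T (k%:R * de + de) F eta - T (k%:R * de) (T de F) eta) +
  nrm C (fun eta => T (k%:R * de) (T de F) eta - T (k%:R * de) F eta - de * T (k%:R * de) H eta) +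
  nrm C (fun eta => 1 * (T (k%:R * de) F eta - F eta - k%:R * de * H eta) +
                  de * (T (k%:R * de) H eta - H eta)))).
  apply: nrm_le3 => //; try exact: LCB; try exact: LCBBZ.
    by apply: LC_lin => //; [exact: LCBBZ|exact: LCB].
  by move=> eta; ring.
rewrite sg_D// add0r.
have b1 := le_trans (sg_BBZ de k0 lde lF lH) hd.
have b2 : nrm C (fun eta => 1 * (T (k%:R * de) F eta - F eta - k%:R * de * H eta) +
    de * (T (k%:R * de) H eta - H eta)) <=
    1 * nrm C (fun eta => T (k%:R * de) F eta - F eta - k%:R * de * H eta) +
    de * nrm C (fun eta => T (k%:R * de) H eta - H eta).
  apply: nrm_le2 => //; [by apply: LC_lin => //; [exact: LCBBZ|exact: LCB]|exact: LCBBZ|exact: LCB|].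
  by move=> eta; rewrite !mul1r -[X in _ + X * `|_|](ger0_norm de0) -normrM ler_normD.
have b3 : de * nrm C (fun eta => T (k%:R * de) H eta - H eta) <= de * (h * nrm C H2).
  apply: ler_wpM2l => //; apply: le_trans (sg_gen1 gH k0) _.
  by rewrite ler_wpM2r// nrm_ge0.
have := IH (ltnW km); move: b1 b2 b3; rewrite mul1r mulrDr; lra.
Qed.

End Semigroup.

(** * Bounds for the generators and the truncated Euler scheme *)

Section Euler.
Variables (R : realType) (d : nat).
Local Notation point := 'rV[R]_d.
Local Notation config := (config R d).
Implicit Types (f g : point -> point -> R) (F G : config -> R).

Lemma LC_mono (c c' : R) F : 0 < c -> c <= c' -> LC c' F ->
  LC c F /\ nrm c F <= nrm c' F.
Proof.
move=> c0 cc' lF; have c'0 := lt_le_trans c0 cc'.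
have h : (normC c F <= normC c' F)%E.
  apply: le_wnorm => n; first by rewrite exprn_ge0// ltW.
  by rewrite lerXn2r// nnegrE ltW.
have l : LC c F by split; [exact: lF.1|exact: le_lt_trans h lF.2].
by split => //; rewrite -lee_fin -!nrmE.
Qed.

Definition trunc m F : config -> R := fun eta => (size eta <= m)%N%:R * F eta.
Definition tail m F : config -> R := fun eta => (m < size eta)%N%:R * F eta.

Lemma LC_size (c : R) (th : nat -> R) F : 0 < c -> (forall n, 0 <= th n <= 1) -> LC c F ->
  LC c (fun eta => th (size eta) * F eta) /\
  nrm c (fun eta => th (size eta) * F eta) <= nrm c F.
Proof.
move=> c0 th01 lF.
have [|h1 h2] := LC_lin_le c0 (@ler01 R) (lexx 0) (conf_fun_size th lF.1) lF lF.
  move=> eta; have /andP[t0 t1] := th01 (size eta).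
  by rewrite mul1r mul0r addr0 normrM (ger0_norm t0) ler_piMl.
by split => //; move: h2; rewrite mul1r mul0r addr0.
Qed.

Lemma LC_trunc (c : R) m F : 0 < c -> LC c F -> LC c (trunc m F) /\ nrm c (trunc m F) <= nrm c F.
Proof.
move=> c0; apply: (LC_size (th := fun n => (n <= m)%N%:R)) => // n.
by case: (n <= m)%N; rewrite ler01 lexx.
Qed.

Lemma LC_tail (c : R) m F : 0 < c -> LC c F -> LC c (tail m F).
Proof.
move=> c0 lF; apply: (proj1 (LC_size (th := fun n => (m < n)%N%:R) c0 _ lF)) => n.
by case: (m < n)%N; rewrite ler01 lexx.
Qed.

(** Stated in the shape of [sg_BBZ] with a = 1. *)
Lemma trunc_tail m F eta : F eta - trunc m F eta - 1 * tail m F eta = 0.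
Proof.
by rewrite /trunc /tail ltnNge; case: (size eta <= m)%N;
  rewrite !(mul0r, mul1r, subr0, subrr).
Qed.

Variables (phi : point -> R) (b C z : R).
Hypotheses (phi0 : forall x, 0 <= phi x) (phiN : forall x, phi (- x) = phi x).
Hypotheses (bphi : borel_meas phi) (phib : intRd (fun x => (phi x)%:E) = b%:E).
Hypotheses (C0 : 0 < C) (z0 : 0 <= z).
Hypotheses (zC : z * expR (C * b) <= C) (z2C : z * expR (2 * C * b) <= 2 * C).

Let CC0 : 0 < 2 * C. Proof. by rewrite mulr_gt0. Qed.

Definition gen f g F : config -> R := fun eta => L1 F eta + splitop z f g F eta.

Lemma conf_fun_L1 F : conf_fun F -> conf_fun (L1 F).
Proof. by move=> cF; exact: (conf_fun_size (fun n => - n%:R) cF). Qed.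

Lemma conf_fun_gen f g F : admissible phi f g -> conf_fun F -> conf_fun (gen f g F).
Proof.
move=> [mf mg _ _] cF.
have := conf_fun_lin 1 1 (conf_fun_L1 cF) (splitop_conf_fun z mf mg cF).
by congr conf_fun; apply/funext => eta; rewrite !mul1r.
Qed.

Lemma wnorm_splitop_le (c k : R) f g F : 0 < c -> z * expR (c * b) <= k * c ->
  admissible phi f g -> conf_fun F ->
  (wnorm (fun n => c ^+ n)%R (splitop z f g F) <= wnorm (fun n => k * (n%:R * c ^+ n))%R F)%E.
Proof.
move=> c0 zk ad cF; apply: le_trans (wnorm_splitop phi0 phiN bphi phib c0 z0 ad cF) _.
apply: le_wnorm => n.
  by rewrite !mulr_ge0 ?expR_ge0 ?invr_ge0 ?exprn_ge0// ltW.
apply: ler_wpM2r; first by rewrite mulr_ge0// exprn_ge0// ltW.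
by rewrite ler_pdivrMr.
Qed.

(** Only weights matter: [L1] contributes n c^n and the gain term at most k n c^n, while [th]
    carries a cut-off in the number of points. The bounds with and without cut-off are all
    instances. *)
Lemma gen_size_bound (c c' k K : R) (th : nat -> R) f g F : 0 < c -> 0 < c' -> 0 <= k ->
  z * expR (c * b) <= k * c -> (forall n, 0 <= th n) ->
  (forall n, (1 + k) * (n%:R * c ^+ n) * th n <= K * c' ^+ n) ->
  admissible phi f g -> LC c' F ->
  LC c (gen f g (fun eta => th (size eta) * F eta)) /\
  nrm c (gen f g (fun eta => th (size eta) * F eta)) <= K * nrm c' F.
Proof.
move=> c0 c'0 k0 zk th0 hK ad lF; have [mf mg _ _] := ad.
have cn n : 0 <= c ^+ n by rewrite exprn_ge0// ltW.
have c'n n : 0 <= c' ^+ n by rewrite exprn_ge0// ltW.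
set G := fun eta => th (size eta) * F eta.
have cG : conf_fun G := conf_fun_size th lF.1.
have h : (normC c (gen f g G) <= K%:E * normC c' F)%E.
  rewrite normCE.
  apply: le_trans (wnorm_triangle cn (conf_fun_gen ad cG) (conf_fun_L1 cG)
    (splitop_conf_fun z mf mg cG) (fun eta => ler_normD _ _)) _.
  have h1 : (wnorm (fun n => c ^+ n)%R (L1 G) <= wnorm (fun n => c ^+ n * n%:R)%R G)%E.
    apply: (wnorm_size (th := fun n => n%:R)) => //; first exact: conf_fun_L1.
    by move=> eta; rewrite normrM normrN normr_nat.
  apply: le_trans (leeD h1 (wnorm_splitop_le c0 zk ad cG)) _.
  rewrite -wnormD; [|by move=> n; rewrite mulr_ge0|by move=> n; rewrite !mulr_ge0].
  apply: (@le_trans _ _ (wnorm (fun n => (c ^+ n * n%:R + k * (n%:R * c ^+ n)) * th n) F)).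
    apply: wnorm_size => //; [by move=> n; rewrite addr_ge0 ?mulr_ge0|exact: lF.1|].
    by move=> eta; rewrite /G normrM (ger0_norm (th0 _)).
  rewrite normCE -wnormZ//; apply: le_wnorm => n.
    by rewrite mulr_ge0// addr_ge0 ?mulr_ge0.
  by apply: le_trans (hK n); rewrite le_eqVlt; apply/orP; left; apply/eqP; ring.
have l : LC c (gen f g G).
  split; first exact: conf_fun_gen.
  by apply: le_lt_trans h _; rewrite nrmE// -EFinM ltry.
by split => //; rewrite -lee_fin -nrmE// EFinM -nrmE.
Qed.

Lemma gen_bound (c c' k K : R) f g F : 0 < c -> 0 < c' -> 0 <= k ->
  z * expR (c * b) <= k * c ->
  (forall n, (1 + k) * (n%:R * c ^+ n) <= K * c' ^+ n) ->
  admissible phi f g -> LC c' F ->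
  LC c (gen f g F) /\ nrm c (gen f g F) <= K * nrm c' F.
Proof.
move=> c0 c'0 k0 zk hK ad lF.
have e : (fun eta => 1 * F eta) = F by apply/funext => eta; rewrite mul1r.
have hK' n : (1 + k) * (n%:R * c ^+ n) * 1 <= K * c' ^+ n by rewrite mulr1.
have := gen_size_bound c0 c'0 k0 zk (fun=> @ler01 R) hK' ad lF.
by rewrite e.
Qed.

Lemma gen_2C f g F : admissible phi f g -> LC (2 * C) F ->
  LC C (gen f g F) /\ nrm C (gen f g F) <= 2 * nrm (2 * C) F.
Proof.
apply: (gen_bound (k := 1)) => //; first by rewrite mul1r.
move=> n; rewrite exprMn (_ : 1 + 1 = 2)//.
have := natr_le_expD n (@ler01 R); rewrite mulr1 (_ : 1 + 1 = 2)// => h.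
by rewrite ler_pM2l// ler_wpM2r// exprn_ge0// ltW.
Qed.

(** Where n > m, n m <= n^2 <= 2^(n+1), hence 2 n C^n <= (4 / m) (2C)^n. *)
Lemma gen_tail m f g F : admissible phi f g -> LC (2 * C) F -> (0 < m)%N ->
  LC C (gen f g (tail m F)) /\ nrm C (gen f g (tail m F)) <= 4 / m%:R * nrm (2 * C) F.
Proof.
move=> ad lF m0.
apply: (gen_size_bound (k := 1) (th := fun n => (m < n)%N%:R)) lF => //.
  by rewrite mul1r.
move=> n; have Cn : 0 <= C ^+ n by rewrite exprn_ge0// ltW.
have [mn|_] := ltnP m n; last by rewrite mulr0 mulr_ge0// ?divr_ge0// exprn_ge0// ltW.
rewrite mulr1 exprMn mulrA [leRHS]mulrA; apply: ler_wpM2r => //.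
rewrite mulrAC ler_pdivlMr ?ltr0n//.
have : (n * m <= 2 ^ n.+1)%N by apply: leq_trans (sqrn_le_exp2 n); rewrite leq_mul// ltnW.
rewrite -(ler_nat R) natrM natrX exprS; lra.
Qed.

(** On at most m points the factor n is bounded by m, so the norm parameter need not shrink. The
    bound 2 m is not uniform, but mere membership is what is used. *)
Lemma gen_trunc m f g F : admissible phi f g -> LC (2 * C) F ->
  LC (2 * C) (gen f g (trunc m F)).
Proof.
move=> ad lF.
suff : LC (2 * C) (gen f g (trunc m F)) /\
    nrm (2 * C) (gen f g (trunc m F)) <= 2 * m%:R * nrm (2 * C) F by case.
apply: (gen_size_bound (k := 1) (th := fun n => (n <= m)%N%:R)) lF => //.
  by rewrite mul1r.
move=> n; have Cn : 0 <= (2 * C) ^+ n by rewrite exprn_ge0// ltW.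
have [nm|_] := leqP n m; last by rewrite mulr0 !mulr_ge0.
rewrite mulr1 mulrA; apply: ler_wpM2r => //.
by rewrite (_ : 1 + 1 = 2)// ler_wpM2l// ler_nat.
Qed.

(** The factors belong to the passages from L_2C to L_{3C/2} and from there to L_C: n <= 3 (4/3)^n
    gives 3, and n <= 2 (3/2)^n, doubled for loss plus gain, gives 4. The gain ratio at 3C/2 is kept
    as it is, since the constant only multiplies h^2. *)
Definition gen2_const : R := 4 * (3 * (1 + z * expR (3 / 2 * C * b) / (3 / 2 * C))).

Lemma gen2_const_ge0 : 0 <= gen2_const.
Proof.
rewrite /gen2_const !mulr_ge0// addr_ge0// divr_ge0 ?mulr_ge0 ?expR_ge0//.
exact: ltW.
Qed.

Lemma gen2_bound f g F : admissible phi f g -> LC (2 * C) F ->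
  nrm C (gen f g (gen f g F)) <= gen2_const * nrm (2 * C) F.
Proof.
move=> ad lF; have D0 : 0 < 3 / 2 * C by rewrite mulr_gt0.
set ka := z * expR (3 / 2 * C * b) / (3 / 2 * C).
have ka0 : 0 <= ka by rewrite divr_ge0 ?mulr_ge0 ?expR_ge0// ltW.
have [l1 n1] : LC (3 / 2 * C) (gen f g F) /\
    nrm (3 / 2 * C) (gen f g F) <= 3 * (1 + ka) * nrm (2 * C) F.
  apply: (gen_bound (k := ka)) => //; first by rewrite divfK// gt_eqF.
  move=> n; rewrite [leRHS](_ : _ = (1 + ka) * (3 * (2 * C) ^+ n)); last by ring.
  apply: ler_wpM2l; first by rewrite addr_ge0.
  have -> : 2 * C = (1 + 3^-1) * (3 / 2 * C) by field.
  have h0 : 0 <= 3^-1 :> R by rewrite invr_ge0.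
  have := natr_le_expD n h0; rewrite ler_pdivrMr// [_ * 3]mulrC => h.
  rewrite [((1 + _) * _) ^+ n]exprMn [leRHS]mulrA.
  by apply: ler_wpM2r => //; rewrite exprn_ge0// ltW.
have [_ n2] : LC C (gen f g (gen f g F)) /\
    nrm C (gen f g (gen f g F)) <= 4 * nrm (3 / 2 * C) (gen f g F).
  apply: (gen_bound (k := 1)) => //; first by rewrite mul1r.
  move=> n; have -> : 3 / 2 * C = (1 + 2^-1) * C by field.
  have h0 : 0 <= 2^-1 :> R by rewrite invr_ge0.
  have := natr_le_expD n h0; rewrite exprMn ler_pdivrMr// => h.
  rewrite mulrA [leRHS]mulrA; apply: ler_wpM2r; first by rewrite exprn_ge0// ltW.
  by move: h; set X := (1 + _) ^+ n; lra.
apply: le_trans n2 _; rewrite /gen2_const -[leRHS]mulrA; exact: ler_wpM2l.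
Qed.

Definition euler m h f g F : config -> R := fun eta => F eta + h * gen f g (trunc m F) eta.

Lemma euler_contraction m h f g F : 0 <= h -> h * m%:R <= 1 ->
  admissible phi f g -> LC (2 * C) F ->
  LC (2 * C) (euler m h f g F) /\ nrm (2 * C) (euler m h f g F) <= nrm (2 * C) F.
Proof.
move=> h0 hm ad lF; have [mf mg _ _] := ad.
have cT : conf_fun (trunc m F) := conf_fun_size (fun n => (n <= m)%N%:R) lF.1.
have cE : conf_fun (euler m h f g F).
  have := conf_fun_lin 1 h lF.1 (conf_fun_gen ad cT).
  by congr conf_fun; apply/funext => eta; rewrite mul1r.
(* The factor left by 1 + h L1 on n points after truncation; h m <= 1 keeps it nonnegative. *)
pose th n : R := 1 - h * n%:R * (n <= m)%N%:R.
have th0 n : 0 <= th n.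
  rewrite /th subr_ge0; have [nm|_] := leqP n m; last by rewrite mulr0.
  by rewrite mulr1; apply: le_trans hm; rewrite ler_wpM2l// ler_nat.
pose Phi eta := th (size eta) * F eta.
have cPhi : conf_fun Phi := conf_fun_size th lF.1.
have cn n : 0 <= (2 * C) ^+ n by rewrite exprn_ge0// ltW.
have H : (normC (2 * C) (euler m h f g F) <= normC (2 * C) F)%E.
  have Hd eta : `|euler m h f g F eta| <=
      1 * `|Phi eta| + h * `|splitop z f g (trunc m F) eta|.
    rewrite mul1r -[X in _ + X * `|_|](ger0_norm h0) -normrM.
    rewrite (_ : euler m h f g F eta = Phi eta + h * splitop z f g (trunc m F) eta) ?ler_normD//.
    by rewrite /euler /gen /L1 /Phi /th /trunc; ring.
  have H := normC_lin_le CC0 (@ler01 R) h0 cE cPhi (splitop_conf_fun z mf mg cT) Hd.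
  apply: le_trans H _; rewrite mul1e.
  have h1 : (normC (2 * C) Phi <= wnorm (fun n => (2 * C) ^+ n * th n)%R F)%E.
    apply: wnorm_size => //; first exact: lF.1.
    by move=> eta; rewrite /Phi normrM (ger0_norm (th0 _)).
  have h2 : (normC (2 * C) (splitop z f g (trunc m F)) <=
      wnorm (fun n => (1 * (n%:R * (2 * C) ^+ n)) * (n <= m)%N%:R)%R F)%E.
    apply: (@le_trans _ _ (wnorm (fun n => 1 * (n%:R * (2 * C) ^+ n)) (trunc m F))).
      by apply: wnorm_splitop_le => //; rewrite mul1r.
    apply: (wnorm_size (th := fun n => (n <= m)%N%:R)) => //.
    - by move=> n; rewrite mul1r mulr_ge0.
    - exact: lF.1.
    - by move=> eta; rewrite /trunc normrM normr_nat.
  apply: le_trans (leeD h1 (lee_wpmul2l _ h2)) _; first by rewrite lee_fin.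
  rewrite -wnormZ; last by move=> n; rewrite mul1r !mulr_ge0.
  rewrite -wnormD; first last.
  - by move=> n; rewrite mul1r !mulr_ge0.
  - by move=> n; rewrite mulr_ge0.
  rewrite normCE; apply: le_wnorm => n.
    by rewrite addr_ge0// ?mul1r !mulr_ge0.
  (* The weight lost through [th] is exactly the weight gained from [splitop]. *)
  by rewrite le_eqVlt; apply/orP; left; apply/eqP; rewrite /th; ring.
have l : LC (2 * C) (euler m h f g F) by split => //; exact: le_lt_trans H lF.2.
by split => //; rewrite -lee_fin -!nrmE.
Qed.

Section Error.
Variables (f g f' g' : point -> point -> R).
Variables (T : R -> (config -> R) -> config -> R) (E : R).
Hypotheses (ad : admissible phi f g) (ad' : admissible phi f' g').
Hypothesis gT : generated_by_closure C (gen f g) T.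
Hypothesis hE : forall F, LC (2 * C) F ->
  nrm C (fun eta => gen f g F eta - gen f' g' F eta) <= E * nrm (2 * C) F.
Hypothesis E0 : 0 <= E.

Let C2C : C <= 2 * C. Proof. by rewrite ler_pMl// ler1n. Qed.

Let LC2 F : LC (2 * C) F -> LC C F.
Proof. by move=> lF; have [] := LC_mono C0 C2C lF. Qed.

Lemma normC_subrr G : normC C (fun eta => G eta - G eta) = 0%E.
Proof.
apply: eseries0 => n _ _; rewrite (eq_int_conf (G := fun=> 0%E)).
  by rewrite /int_conf iint0 mule0.
by move=> eta _; rewrite subrr normr0.
Qed.

(** The constant sequence [F] witnesses membership in the graph of the closure. *)
Lemma generator_graph_gen F : LC (2 * C) F -> generator_graph C T F (gen f g F).
Proof.
move=> lF; apply/(proj2 gT); split; first exact: LC2.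
split; first exact: (proj1 (gen_2C ad lF)).
exists (fun=> F); split => //.
by split; rewrite normC_subrr; exact: cvg_cst.
Qed.

(** Up to norm zero the error is the sum of the second-order remainder on the truncated part,
    [T h - 1] on the tail, and h times the difference of the generators on the truncated part. The
    tail gets only a first-order estimate, as [gen] of it need not lie in L_2C. *)
Lemma euler_step m h F : 0 <= h -> (0 < m)%N -> LC (2 * C) F ->
  nrm C (fun eta => T h F eta - euler m h f' g' F eta) <=
  h * (h * gen2_const + 4 / m%:R + E) * nrm (2 * C) F.
Proof.
move=> h0 m0 lF; have sT := proj1 gT.
have [lg ng] := LC_trunc m CC0 lF; have lr := LC_tail m CC0 lF.
have lAg := gen_trunc m ad lF.
have lAg' := gen_trunc m ad' lF.
have [lAr nAr] := gen_tail ad lF m0.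
have b1 : nrm C (fun eta => T h F eta - T h (trunc m F) eta - 1 * T h (tail m F) eta) <= 0.
  apply: le_trans (sg_BBZ C0 sT 1 h0 (LC2 lF) (LC2 lg) (LC2 lr)) _.
  have -> : (fun eta => F eta - trunc m F eta - 1 * tail m F eta) = (fun eta => F eta - F eta).
    by apply/funext => eta; rewrite trunc_tail subrr.
  by rewrite /nrm normC_subrr.
have b2 : nrm C (fun eta => T h (trunc m F) eta - trunc m F eta - h * gen f g (trunc m F) eta)
    <= h * (h * (gen2_const * nrm (2 * C) F)).
  apply: le_trans (sg_gen2 C0 sT (generator_graph_gen lg) (generator_graph_gen lAg) h0) _.
  rewrite !ler_wpM2l//; apply: le_trans (gen2_bound ad lg) _.
  by rewrite ler_wpM2l// gen2_const_ge0.
have b3 : nrm C (fun eta => T h (tail m F) eta - tail m F eta) <=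
    h * (4 / m%:R * nrm (2 * C) F).
  apply: le_trans (sg_gen1 C0 sT (generator_graph_gen lr) h0) _.
  by rewrite ler_wpM2l.
have b4 : nrm C (fun eta => gen f g (trunc m F) eta - gen f' g' (trunc m F) eta) <=
    E * nrm (2 * C) F.
  by apply: le_trans (hE lg) _; rewrite ler_wpM2l.
have lTF := sg_LC sT h0 (LC2 lF).
have lTg := sg_LC sT h0 (LC2 lg).
have lTr := sg_LC sT h0 (LC2 lr).
pose A eta := 1 * (T h (tail m F) eta - tail m F eta) +
  h * (gen f g (trunc m F) eta - gen f' g' (trunc m F) eta).
have lD : LC C (fun eta => gen f g (trunc m F) eta - gen f' g' (trunc m F) eta).
  by apply: LCB => //; exact: LC2.
have lrr : LC C (fun eta => T h (tail m F) eta - tail m F eta).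
  by apply: LCB => //; exact: LC2.
have lA : LC C A by exact: LC_lin.
have nA : nrm C A <= 1 * nrm C (fun eta => T h (tail m F) eta - tail m F eta) +
    h * nrm C (fun eta => gen f g (trunc m F) eta - gen f' g' (trunc m F) eta).
  apply: nrm_le2 => // eta.
  by rewrite /A !mul1r -[X in _ + X * `|_|](ger0_norm h0) -normrM ler_normD.
have lEu : LC C (euler m h f' g' F).
  have := LC_lin C0 1 h (LC2 lF) (LC2 lAg').
  by congr (LC C); apply/funext => eta; rewrite mul1r.
have : nrm C (fun eta => T h F eta - euler m h f' g' F eta) <=
  nrm C (fun eta => T h F eta - T h (trunc m F) eta - 1 * T h (tail m F) eta) +
  nrm C (fun eta => T h (trunc m F) eta - trunc m F eta - h * gen f g (trunc m F) eta) +
  nrm C A.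
  apply: nrm_le3 => //.
  - exact: LCB.
  - exact: LCBBZ.
  - by apply: LCBBZ => //; exact: LC2.
  - by move=> eta; rewrite /A /euler; have := trunc_tail m F eta; lra.
have := ler_wpM2l h0 b4; move: b1 b2 b3 nA; lra.
Qed.

(** Contractivity of [T h] on L_C propagates the accumulated error, while each new error is measured
    by the L_2C norm of the current iterate, which never exceeds that of [F]. *)
Lemma euler_error m h F k : 0 <= h -> (0 < m)%N -> h * m%:R <= 1 -> LC (2 * C) F ->
  [/\ LC (2 * C) (iter k (euler m h f' g') F),
   nrm (2 * C) (iter k (euler m h f' g') F) <= nrm (2 * C) F &
  nrm C (fun eta => T (k%:R * h) F eta - iter k (euler m h f' g') F eta) <=
  k%:R * (h * (h * gen2_const + 4 / m%:R + E) * nrm (2 * C) F)].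
Proof.
move=> h0 m0 hm lF; have sT := proj1 gT.
elim: k => [|k [lk nk ek]] /=; first by split => //; rewrite !mul0r (sg_0 sT)//; exact: LC2.
have [lk1 nk1] := euler_contraction h0 hm ad' lk.
split => //; first exact: le_trans nk1 nk.
set Fk := iter k _ _ in lk nk ek lk1 nk1 *.
have k0 : 0 <= k%:R * h by rewrite mulr_ge0.
have kh0 : 0 <= h + k%:R * h by rewrite addr_ge0.
set X := h * _ * nrm (2 * C) F in ek *.
rewrite -natr1 [k%:R + 1]addrC !mulrDl !mul1r.
have lTk := sg_LC sT k0 (LC2 lF).
apply: (@le_trans _ _ (nrm C (fun eta => T (h + k%:R * h) F eta - T h (T (k%:R * h) F) eta) +
   nrm C (fun eta => T h (T (k%:R * h) F) eta - T h Fk eta) +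
   nrm C (fun eta => T h Fk eta - euler m h f' g' Fk eta))).
  apply: nrm_le3 => //; try (apply: LCB => //; by [exact: LC2|exact: sg_LC|apply: sg_LC => //; exact: LC2]).
  by move=> eta; ring.
rewrite (sg_D sT)// ?add0r; last exact: LC2.
rewrite addrC; apply: lerD.
  apply: le_trans (euler_step h0 m0 lk) _; rewrite ler_wpM2l// mulr_ge0//.
  apply: addr_ge0 => //; apply: addr_ge0; last exact: divr_ge0.
  by apply: mulr_ge0 => //; exact: gen2_const_ge0.
by apply: le_trans (sg_B C0 sT h0 lTk (LC2 lk)) _.
Qed.

End Error.

Lemma semigroup_dist f g f' g' (T T' : R -> (config -> R) -> config -> R) (E t : R) F :
  admissible phi f g -> admissible phi f' g' ->
  generated_by_closure C (gen f g) T -> generated_by_closure C (gen f' g') T' ->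
  (forall F, LC (2 * C) F ->
     nrm C (fun eta => gen f g F eta - gen f' g' F eta) <= E * nrm (2 * C) F) ->
  0 <= E -> 0 <= t -> LC (2 * C) F ->
  nrm C (fun eta => T t F eta - T' t F eta) <= t * E * nrm (2 * C) F.
Proof.
move=> ad ad' gT gT' hE E0 t0 lF; apply/ler_addgt0Pr => e e0.
have lFC : LC C F by have [] := LC_mono C0 _ lF; rewrite // ler_pMl// ler1n.
have B0 : 0 <= nrm (2 * C) F := nrm_ge0 CC0 F.
set B := nrm (2 * C) F in B0 *.
have K0 := gen2_const_ge0; set K := gen2_const in K0.
have [p p0 tp] : exists2 p : nat, (0 < p)%N & t <= p%:R.
  by exists (Num.truncn t).+1 => //; rewrite ltW// truncnS_gt.
(* The two scheme errors add up to t (2 h K + 8 / m) B, and h <= t / m bounds this by A / m. *)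
pose A := t * (2 * t * K + 8) * B.
have A0 : 0 <= A.
  apply: mulr_ge0 => //; apply: mulr_ge0 => //; apply: addr_ge0 => //.
  by apply: mulr_ge0 => //; exact: mulr_ge0.
have [m m0 Am] : exists2 m : nat, (0 < m)%N & A / m%:R <= e.
  exists (Num.truncn (A / e)).+1 => //.
  by rewrite ler_pdivrMr ?ltr0n// mulrC -ler_pdivrMr// ltW// truncnS_gt.
have mp : 0 < m%:R :> R by rewrite ltr0n.
have pp : 0 < p%:R :> R by rewrite ltr0n.
(* With n = m p steps, h m = t / p <= 1 as the contraction requires, and h <= t / m. *)
pose n := (m * p)%N; pose h := t / n%:R.
have h0 : 0 <= h by rewrite divr_ge0.
have nh : n%:R * h = t by rewrite mulrC divfK// natrM mulf_neq0// gt_eqF.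
have hm : h * m%:R <= 1.
  rewrite (_ : h * m%:R = t / p%:R) ?ler_pdivrMr ?mul1r//.
  by rewrite /h /n natrM; field; rewrite !gt_eqF.
have ht : h <= t / m%:R.
  rewrite /h /n natrM invfM mulrA ler_piMr ?divr_ge0//.
  by rewrite invf_le1// ler1n.
(* [T'] is compared with the scheme of its own generator, so its defect constant is 0. *)
have hE0 G : LC (2 * C) G ->
    nrm C (fun eta => gen f' g' G eta - gen f' g' G eta) <= 0 * nrm (2 * C) G.
  by move=> _; rewrite mul0r /nrm normC_subrr.
have [_ _ e1] := euler_error ad ad' gT hE E0 n h0 m0 hm lF.
have [ln _ e2] := euler_error ad' ad' gT' hE0 (lexx 0) n h0 m0 hm lF.
rewrite -/B -/K nh in e1 e2.
set Fn := iter n _ F in ln e1 e2.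
have lFn : LC C Fn by have [] := LC_mono C0 _ ln; rewrite // ler_pMl// ler1n.
have lT := sg_LC (proj1 gT) t0 lFC; have lT' := sg_LC (proj1 gT') t0 lFC.
apply: (@le_trans _ _ (1 * nrm C (fun eta => T t F eta - Fn eta) +
   1 * nrm C (fun eta => T' t F eta - Fn eta))).
  apply: (nrm_le2 C0 (@ler01 R) (@ler01 R) (LCB C0 lT lT') (LCB C0 lT lFn) (LCB C0 lT' lFn)).
  move=> eta; rewrite !mul1r -[X in _ <= _ + X]normrN; apply: le_trans (ler_normD _ _).
  by rewrite opprB addrA subrK.
rewrite !mul1r; apply: le_trans (lerD e1 e2) _.
have q1 : n%:R * (h * (h * K + 4 / m%:R + E) * B) = t * (h * K + 4 / m%:R + E) * B.
  by rewrite -nh; ring.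
have q2 : n%:R * (h * (h * K + 4 / m%:R + 0) * B) = t * (h * K + 4 / m%:R) * B.
  by rewrite -nh; ring.
rewrite q1 q2 [leLHS](_ : _ = t * E * B + t * (2 * h * K + 8 / m%:R) * B); last by ring.
rewrite lerD2l; apply: le_trans Am.
have := ler_wpM2l t0 (ler_wpM2r (mulr_ge0 K0 B0) ht).
by rewrite /A; set mi := m%:R^-1; lra.
Qed.

End Euler.

(** * Density of L_2C in L_C by truncation *)

Section Density.
Variables (R : realType) (d : nat) (C : R).
Hypothesis C0 : 0 < C.
Implicit Types F : config R d -> R.

Let Cn0 n : 0 <= C ^+ n. Proof. by rewrite exprn_ge0// ltW. Qed.

(** On at most m points the weights (2C)^n and C^n differ by a factor of at most 2^m. *)
Lemma trunc_LC2 m F : LC C F -> LC (2 * C) (trunc m F).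
Proof.
move=> lF; have cT := conf_fun_size (fun n => (n <= m)%N%:R) lF.1.
have CCn n : 0 <= (2 * C) ^+ n by rewrite exprn_ge0// mulr_ge0// ltW.
split; first exact: cT.
apply: (@le_lt_trans _ _ ((2 ^+ m)%:E * normC C F)%E); last by rewrite nrmE// -EFinM ltry.
rewrite !normCE -wnormZ//.
apply: (@le_trans _ _ (wnorm (fun n => (2 * C) ^+ n * (n <= m)%N%:R) F)).
  by apply: (wnorm_size (th := fun n => (n <= m)%N%:R)) lF.1 _ => // eta; rewrite normrM normr_nat.
apply: le_wnorm => n; first by rewrite mulr_ge0.
have [nm|_] := leqP n m; last by rewrite mulr0 mulr_ge0// exprn_ge0.
by rewrite mulr1 exprMn ler_wpM2r// ler_weXn2l// ler1n.
Qed.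

Lemma nrm_tail_small F e : LC C F -> 0 < e -> exists m, nrm C (tail m F) < e.
Proof.
move=> lF e0.
pose u n := ((C ^+ n / n`!%:R)%:E * int_conf n (fun eta => (`|F eta|)%:E))%E.
have u0 n : (0 <= u n)%E.
  by rewrite mule_ge0 ?int_conf_norm_ge0// lee_fin divr_ge0.
have cv := nneseries_tail_cvg (P := xpredT) lF.2 (fun k _ => u0 k).
have : nbhs (0 : \bar R) [set x | (x < e%:E)%E].
  by apply: open_nbhs_nbhs; split; [exact: open_ereal_lt_ereal|rewrite /= lte_fin].
(* The series remainder is taken from index m+1, where [tail m] begins. *)
move/cv => -[m _ /(_ m.+1 (leqnSn m))/= hm]; exists m.
rewrite -lte_fin -(nrmE C0); last exact: LC_tail.
apply: le_lt_trans hm.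
pose w n := C ^+ n * (m < n)%N%:R.
have w0 n : 0 <= w n by rewrite mulr_ge0.
have wt0 n : (0 <= (w n / n`!%:R)%:E * int_conf n (fun eta => (`|F eta|)%:E))%E.
  by rewrite mule_ge0 ?int_conf_norm_ge0// lee_fin divr_ge0.
apply: (@le_trans _ _ (wnorm w F)).
  apply: (wnorm_size (th := fun n => (m < n)%N%:R)) lF.1 _ => //.
    exact: (conf_fun_size (fun n => (m < n)%N%:R) lF.1).
  by move=> eta; rewrite normrM normr_nat.
rewrite /wnorm (nneseries_split 0 m.+1)// add0n big_nat_cond big1 ?add0e; last first.
  move=> n /andP[/andP[_ nm] _]; rewrite /w ltnNge -ltnS nm/= mulr0 mul0r.
  by rewrite mul0e.
apply: lee_nneseries => // n _; rewrite /u lee_wpmul2r ?int_conf_norm_ge0//.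
by rewrite lee_fin ler_wpM2r// /w; case: (m < n)%N; rewrite ?mulr1 ?mulr0.
Qed.

End Density.

(** * The rescaled kernels and their distance from the Vlasov kernels *)

Section VlasovScaling.
Variables (R : realType) (d : nat) (phi : 'rV[R]_d -> R).
Hypotheses (phi0 : forall x, 0 <= phi x) (bphi : borel_meas phi).

Definition eps_kernel (eps : R) (x y : 'rV[R]_d) : R := expR (- (eps * phi (x - y))).
Definition eps_mayer (eps : R) (x y : 'rV[R]_d) : R :=
  (expR (- (eps * phi (x - y))) - 1) / eps.
Definition vlasov_kernel (x y : 'rV[R]_d) : R := - phi (x - y).

Lemma LV_gen z : LV z phi = gen z (@unit_kernel R d) vlasov_kernel.
Proof.
apply/funext => G; apply/funext => eta; congr (_ + z * _); apply: eq_bigr => p _.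
congr fine; apply: eq_intRd => x.
by rewrite /kernel_term elam_unit_kernel mul1r mulrC.
Qed.

Lemma kmeas_eps_kernel eps : kmeas (eps_kernel eps).
Proof.
move=> dW W p q mp mq; apply: measurableT_comp; first exact: measurable_expR.
apply: measurableT_comp => //; apply: measurable_funM => //.
exact: (kmeas_pair_pot bphi).
Qed.

Lemma admissible_eps eps : 0 < eps -> admissible phi (eps_kernel eps) (eps_mayer eps).
Proof.
move=> e0; have a0 x y : 0 <= eps * phi (x - y) by rewrite mulr_ge0// ltW.
have e1 x y : expR (- (eps * phi (x - y))) <= 1 by rewrite -expR0 ler_expR oppr_le0.
split.
- exact: kmeas_eps_kernel.
- move=> dW W p q mp mq; apply: measurable_funM => //; apply: measurable_funB => //.
  exact: kmeas_eps_kernel.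
- by move=> x y; rewrite ger0_norm ?expR_ge0// /eps_kernel e1.
- have ei : 0 <= eps^-1 by rewrite invr_ge0 ltW.
  move=> x y; rewrite normrM (ger0_norm ei).
  rewrite ler_pdivrMr// ler0_norm ?subr_le0// opprB /pair_pot [leRHS]mulrC.
  by have := expR_ge1Dx (- (eps * phi (x - y))); lra.
Qed.

Lemma admissible_vlasov : admissible phi (@unit_kernel R d) vlasov_kernel.
Proof.
split.
- exact: kmeas_unit_kernel.
- by move=> dW W p q mp mq; apply: measurableT_comp => //; exact: (kmeas_pair_pot bphi).
- by move=> x y; rewrite normr1.
- by move=> x y; rewrite normrN ger0_norm.
Qed.

Variables (M eps : R).
Hypotheses (phiM : forall x, phi x <= M) (e0 : 0 < eps).

Lemma eps_kernel_dist x y : `|eps_kernel eps x y - unit_kernel x y| <= eps * M.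
Proof.
have a0 : 0 <= eps * phi (x - y) by rewrite mulr_ge0// ltW.
have aM : eps * phi (x - y) <= eps * M by rewrite ler_pM2l.
rewrite /unit_kernel /eps_kernel ler0_norm; last by rewrite subr_le0 -expR0 ler_expR oppr_le0.
by rewrite opprB; have := expR_ge1Dx (- (eps * phi (x - y))); lra.
Qed.

(** From 0 <= e^(-a) - 1 + a <= a^2 / 2 with a = eps t: dividing by eps leaves eps t^2 / 2, and one
    factor t is bounded by [M] while the other stays as the pair potential. *)
Lemma eps_mayer_dist x y :
  `|eps_mayer eps x y - vlasov_kernel x y| <= eps * M / 2 * pair_pot phi x y.
Proof.
rewrite /eps_mayer /vlasov_kernel /pair_pot opprK; set t := phi (x - y).
have t0 : 0 <= t by exact: phi0.
have tM : t <= M by exact: phiM.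
have a0 : 0 <= eps * t by rewrite mulr_ge0// ltW.
have l := expR_ge1Dx (- (eps * t)); have u := expRN_le_quadratic a0.
have -> : (expR (- (eps * t)) - 1) / eps + t = (expR (- (eps * t)) - 1 + eps * t) / eps.
  by field; rewrite gt_eqF.
rewrite ger0_norm; last by rewrite divr_ge0 ?(ltW e0)//; lra.
rewrite ler_pdivrMr//.
have : eps ^+ 2 * t * t <= eps ^+ 2 * t * M by rewrite ler_wpM2l// mulr_ge0// sqr_ge0.
by move: u; lra.
Qed.

End VlasovScaling.

(** * The estimate on L_2C and its extension to convergence on L_C *)

Theorem mainTheorem7 (R : realType) (d : nat) (phi : 'rV[R]_d -> R) (C z : R)
    (Teps : R -> R -> (config R d -> R) -> (config R d -> R))
    (TV : R -> (config R d -> R) -> (config R d -> R)) :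
  (forall x, 0 <= phi x) ->
  (forall x, phi (- x) = phi x) ->
  borel_meas phi ->
  1 < C ->
  (intRd (fun x => (phi x)%:E) < +oo)%E ->
  (exists M, forall x, phi x <= M) ->
  let beta := fine (intRd (fun x => (phi x)%:E)) in
  let phibar := sup (range phi) in
  0 < z ->
  z <= Num.min (C * expR (- (C * beta))) (2 * C * expR (- (2 * C * beta))) ->
  (forall eps, 0 < eps -> generated_by_closure C (Lren z eps phi) (Teps eps)) ->
  generated_by_closure C (LV z phi) TV ->
  (forall (G : config R d -> R) (t eps : R), LC (2 * C) G -> 0 <= t -> 0 < eps ->
     (normC C (fun eta => (Teps eps t G eta - TV t G eta)%R)
      <= (eps * t * phibar * (1 + beta))%R%:E * normC (2 * C) G)%E) /\
  (forall (G : config R d -> R) (tau : R), LC C G -> 0 <= tau ->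
     forall delta : R, 0 < delta -> exists eps0 : R, 0 < eps0 /\
       forall eps t : R, 0 < eps -> eps < eps0 -> 0 <= t -> t <= tau ->
         (normC C (fun eta => (Teps eps t G eta - TV t G eta)%R) < delta%:E)%E).
Proof.
move=> phi0 phiN bphi C1 phifin [M0 phiM0] beta phibar z0 zmin gTeps gTV.
have C0 : 0 < C := lt_trans ltr01 C1.
have CC0 : 0 < 2 * C by rewrite mulr_gt0.
have phib : intRd (fun x => (phi x)%:E) = beta%:E.
  by rewrite fineK// ge0_fin_numE//; apply: intRd_ge0 => x; rewrite lee_fin.
have beta0 : 0 <= beta by rewrite fine_ge0//; apply: intRd_ge0 => x; rewrite lee_fin.
have phiM x : phi x <= phibar.
  by apply: ub_le_sup; [exists M0 => _ [y _ <-]|exists x].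
have M0' : 0 <= phibar by apply: le_trans (phi0 0) (phiM 0).
have zexp c : z <= c * expR (- (c * beta)) -> z * expR (c * beta) <= c.
  by rewrite expRN -ler_pdivlMr ?invr_gt0 ?expR_gt0// invrK.
move: zmin; rewrite le_min => /andP[/zexp zC /zexp z2C].
have z0' := ltW z0.
have adV := admissible_vlasov phi0 bphi.
rewrite LV_gen in gTV.
have dist eps t F : 0 < eps -> 0 <= t -> LC (2 * C) F ->
    nrm C (fun eta => Teps eps t F eta - TV t F eta) <= t * (eps * phibar) * nrm (2 * C) F.
  move=> e0 t0 lF; have adE := admissible_eps phi0 bphi e0.
  (* [Lren] is convertible to [gen] with the kernels [eps_kernel] and [eps_mayer]. *)
  apply: (semigroup_dist phi0 phiN bphi phib C0 z0' zC z2C adE adV (gTeps _ e0) gTV) => //; last first.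
    by rewrite mulr_ge0// ltW.
  move=> G lG.
  have -> : (fun eta => gen z (eps_kernel phi eps) (eps_mayer phi eps) G eta -
      gen z (@unit_kernel R d) (vlasov_kernel phi) G eta) =
    (fun eta => splitop z (eps_kernel phi eps) (eps_mayer phi eps) G eta -
      splitop z (@unit_kernel R d) (vlasov_kernel phi) G eta).
    by apply/funext => eta; rewrite /gen; ring.
  have al0 : 0 <= eps * phibar by rewrite mulr_ge0// ltW.
  have h := wnorm_splitopB phi0 phiN bphi phib C0 z0' al0 zC z2C adE adV
    (eps_kernel_dist phi0 phiM e0) (eps_mayer_dist phi0 phiM e0) lG.
  rewrite (nrmE CC0 lG) -EFinM in h.
  by rewrite -lee_fin; apply: le_trans (nrm_le_normC C0 _) h.
have lT (t : R) eps F : 0 <= t -> 0 < eps -> LC C F -> LC C (Teps eps t F).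
  by move=> t0 e0; apply: sg_LC => //; exact: (proj1 (gTeps _ e0)).
have lTV (t : R) F : 0 <= t -> LC C F -> LC C (TV t F).
  by move=> t0; apply: sg_LC => //; exact: (proj1 gTV).
have LC21 (F : config R d -> R) : LC (2 * C) F -> LC C F.
  by move=> lF; have [] := LC_mono C0 _ lF; rewrite // ler_pMl// ler1n.
split=> [G t eps lG t0 e0|G tau lG tau0 delta delta0].
  have lGC := LC21 _ lG.
  rewrite (nrmE CC0 lG) nrmE//; last by apply: LCB => //; [exact: lT|exact: lTV].
  rewrite -EFinM lee_fin; apply: le_trans (dist _ _ _ e0 t0 lG) _.
  apply: ler_wpM2r; first exact: nrm_ge0.
  (* The factor 1 + beta enters here, through beta >= 0. *)
  rewrite mulrA [t * eps]mulrC ler_peMr//; last by rewrite lerDl.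
  by rewrite !mulr_ge0// ltW.
(* Two tail errors and one error on the truncated function, each at most delta / 4, stay below
   delta. *)
have [m hm] := nrm_tail_small C0 lG (divr_gt0 delta0 (ltr0Sn R 3)).
have lg := trunc_LC2 C0 m lG.
set g := trunc m G in lg.
have lgC := LC21 _ lg.
have hg : nrm C (fun eta => G eta - g eta) < delta / 4.
  apply: le_lt_trans hm; apply: nrm_le1 => //; [exact: LCB|exact: LC_tail|].
  move=> eta; rewrite (_ : G eta - g eta = tail m G eta)//.
  by apply/eqP; rewrite -subr_eq0 -[tail _ _ _]mul1r trunc_tail.
pose B := tau * phibar * nrm (2 * C) g.
have B0 : 0 <= B by rewrite /B !mulr_ge0// nrm_ge0.
(* On [0, tau] the distance for the truncated function is at most eps B; the summand 1 covers B =
   0. *)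
exists (delta / 4 / (B + 1)); split; first by rewrite !divr_gt0// ltr_wpDl.
move=> eps t e0 ee0 t0 tt.
have lD : LC C (fun eta => Teps eps t G eta - TV t G eta).
  by apply: LCB => //; [exact: lT|exact: lTV].
rewrite nrmE// lte_fin.
have n1 : nrm C (fun eta => Teps eps t G eta - Teps eps t g eta) <= nrm C (fun eta => G eta - g eta).
  exact: (sg_B C0 (proj1 (gTeps _ e0))).
have n3 : nrm C (fun eta => TV t g eta - TV t G eta) <= nrm C (fun eta => G eta - g eta).
  apply: le_trans (sg_B C0 (proj1 gTV) t0 lgC lG) _.
  by apply: nrm_le1 => //; [exact: LCB|exact: LCB|move=> eta; rewrite distrC].
have n2 : nrm C (fun eta => Teps eps t g eta - TV t g eta) <= delta / 4.
  apply: le_trans (dist _ _ _ e0 t0 lg) _.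
  apply: (@le_trans _ _ (eps * B)).
    rewrite /B [leRHS]mulrA ler_wpM2r ?nrm_ge0//.
    by rewrite mulrCA ler_pM2l// ler_wpM2r.
  move: ee0; rewrite ltr_pdivlMr ?ltr_wpDl// => h.
  by apply: le_trans (ltW h); rewrite ler_pM2l// lerDl.
have := nrm_le3 C0 lD (LCB C0 (lT t eps G t0 e0 lG) (lT t eps g t0 e0 lgC))
  (LCB C0 (lT t eps g t0 e0 lgC) (lTV t g t0 lgC)) (LCB C0 (lTV t g t0 lgC) (lTV t G t0 lG)).
have tri eta : Teps eps t G eta - TV t G eta = Teps eps t G eta - Teps eps t g eta +
   (Teps eps t g eta - TV t g eta) + (TV t g eta - TV t G eta) by ring.
by move=> /(_ tri); move: n1 n2 n3 hg delta0; lra.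
Qed.
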